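(* Assume that $F$ is continuously differentiable, strictly convex and positive definite. For $x_0\in\mathbb{R}^n$, let $u^\infty$ and $x^\infty$ be an optimal control and associated trajectory for $(OCP)^{lim}_\infty$ starting from $x_0$. Then: 1. $x^\infty$ admits a unique extremal lift $(x^\infty,p^\infty)$, i.e. there is a unique absolutely continuous $p^\infty:[0,\infty)\to\mathbb{R}^n$ such that $(x^\infty,p^\infty)$ is a solution on $[0,\infty)$ of $$\dot x\in J_nx+\lfloor p_n\rceil^0e_n,\qquad\dot p=-J_n^\top p+\nabla F(x),$$ with $u^\infty(t)\in\lfloor p_n^\infty(t)\rceil^0$ for almost every $t\ge0$. 2. There exists a $\mathcal{K}_\infty$-function $C(\cdot)$ (independent of $x_0$) such that $\|(x^\infty,p^\infty)\|_\infty\le C(\|x_0\|)$ for every $x_0\in\mathbb{R}^n$, where $\|\cdot\|_\infty$ is the supremum norm over $t\ge0$; moreover $\lim_{t\to\infty}(x^\infty(t),p^\infty(t))=(0,0)$.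
   Context: Let $n\ge1$ be an integer, $J_n$ the $n\times n$ Jordan block with eigenvalue $0$ (ones on the superdiagonal, zeros elsewhere) and $e_n$ the last canonical basis vector of $\mathbb{R}^n$. The control system is $\dot x=J_nx+e_nu$. The function $F:\mathbb{R}^n\to\mathbb{R}_{\ge0}$ is positive definite if $F(0)=0$ and $F(x)>0$ for $x\ne0$. $(OCP)^{lim}_\infty$ is the problem of minimizing $\mathcal{K}_\infty(x_0,u)=\int_0^\infty F(x(t))\,dt$ over measurable controls $u\in L^\infty(\mathbb{R}_{\ge0},[-1,1])$, where $x(\cdot)$ is the trajectory of the control system with $x(0)=x_0$ and control $u$. For $a\in\mathbb{R}$, $\lfloor a\rceil^0=\mathrm{sgn}(a)$ denotes the set-valued sign: $\{a/|a|\}$ for $a\ne0$ and $[-1,1]$ for $a=0$. A $\mathcal{K}_\infty$-function is a continuous, strictly increasing, unbounded function $\alpha:\mathbb{R}_{\ge0}\to\mathbb{R}_{\ge0}$ with $\alpha(0)=0$. Solutions of the differential inclusion are absolutely continuous functions satisfying it for almost every $t$. *)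

(* Defs.v *)
From HB Require Import structures.
From mathcomp Require Import all_boot all_order all_algebra.
From mathcomp Require Import all_classical all_reals all_analysis.

Set Implicit Arguments.
Unset Strict Implicit.
Unset Printing Implicit Defensive.

Import Order.TTheory GRing.Theory Num.Theory.
Import numFieldNormedType.Exports.

Local Open Scope classical_set_scope.
Local Open Scope ring_scope.

(* The state space is R^(n.+1), so that the dimension is at least 1; its vectors
   are column matrices. *)

Section vectors.
Context {R : realType}.

(* The norm `|x| that MathComp-Analysis puts on matrices is the max norm. *)
Definition enorm (n : nat) (x : 'cV[R]_n) : R :=
  Num.sqrt (\sum_(i < n) x i 0 ^+ 2).

Definition jordan0 (n : nat) : 'M[R]_n :=
  \matrix_(i < n, j < n) (j == i.+1 :> nat)%:R.

Definition elast (n : nat) : 'cV[R]_n.+1 := delta_mx ord_max 0.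

Definition gradient (n : nat) (F : 'cV[R]_n.+1 -> R) (x : 'cV[R]_n.+1) :
    'cV[R]_n.+1 :=
  \col_(i < n.+1) 'D_(delta_mx i 0 : 'cV[R]_n.+1) F x.

Definition continuously_differentiable (n : nat) (F : 'cV[R]_n.+1 -> R) : Prop :=
  (forall x, differentiable F x) /\ continuous (gradient F).

Definition strictly_convex (n : nat) (F : 'cV[R]_n -> R) : Prop :=
  forall (x y : 'cV[R]_n) (a : R), x != y -> 0 < a < 1 ->
    F (a *: x + (1 - a) *: y) < a * F x + (1 - a) * F y.

Definition positive_definite (n : nat) (F : 'cV[R]_n -> R) : Prop :=
  F 0 = 0 /\ forall x, x != 0 -> 0 < F x.

(* Only the values on [0, +oo[ matter. *)
Definition class_Kinfty (C : R -> R) : Prop :=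
  [/\ {within `[0, +oo[, continuous C},
      {in `[0, +oo[ &, {homo C : r s / r < s}},
      (forall M, exists2 r, 0 <= r & M < C r)
    & C 0 = 0].

Definition set_sgn (a : R) : set R :=
  if a == 0 then `[-1, 1]%classic else [set a / `|a|].

(* The pairs in [s] are the endpoints of finitely many non-overlapping
   subintervals of [a, b]. *)
Definition abs_continuous (V : normedModType R) (a b : R) (f : R -> V) : Prop :=
  forall e : R, 0 < e -> exists2 d : R, 0 < d &
    forall s : seq (R * R),
      all (fun I => [&& a <= I.1, I.1 <= I.2 & I.2 <= b]) s ->
      pairwise (fun I K => (I.2 <= K.1) || (K.2 <= I.1)) s ->
      \sum_(I <- s) (I.2 - I.1) < d ->
      \sum_(I <- s) `|f I.2 - f I.1| < e.

(* On the half-line, absolute continuity is required on compact subintervals. *)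
Definition abs_continuous_half_line (V : normedModType R) (f : R -> V) : Prop :=
  forall T : R, 0 <= T -> abs_continuous 0 T f.

End vectors.

Arguments jordan0 R n : clear implicits.
Arguments elast R n : clear implicits.

(* Controls, trajectories and adjoint arcs live on [0, +oo[; they are encoded as
   functions on R whose values at negative times are irrelevant. *)
Section control.
Context {R : realType} {n : nat}.
Implicit Types (F : 'cV[R]_n.+1 -> R) (u : R -> R)
  (x p : R -> 'cV[R]_n.+1).

Definition admissible_control u : Prop :=
  measurable_fun (`[0, +oo[ : set R) u /\
  {ae lebesgue_measure, forall t : R, 0 <= t -> -1 <= u t <= 1}.

Definition trajectory (x0 : 'cV[R]_n.+1) u x : Prop :=
  [/\ x 0 = x0, abs_continuous_half_line x &
    {ae lebesgue_measure, forall t : R, 0 <= t ->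
      is_derive t 1 x (jordan0 R n.+1 *m x t + u t *: elast R n)}].

Definition cost F x : \bar R :=
  (\int[lebesgue_measure]_(t in `[0%R, +oo[) (F (x t))%:E)%E.

Definition optimal F (x0 : 'cV[R]_n.+1) u x : Prop :=
  [/\ admissible_control u, trajectory x0 u x &
    forall v y, admissible_control v -> trajectory x0 v y ->
      (cost F x <= cost F y)%E].

Definition extremal F x p : Prop :=
  [/\ abs_continuous_half_line x, abs_continuous_half_line p,
    {ae lebesgue_measure, forall t : R, 0 <= t ->
      exists2 w, set_sgn (p t ord_max 0) w &
        is_derive t 1 x (jordan0 R n.+1 *m x t + w *: elast R n)} &
    {ae lebesgue_measure, forall t : R, 0 <= t ->
      is_derive t 1 p (- (jordan0 R n.+1)^T *m p t + gradient F (x t))}].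

Definition extremal_lift F u x p : Prop :=
  extremal F x p /\
  {ae lebesgue_measure, forall t : R, 0 <= t -> set_sgn (p t ord_max 0) (u t)}.

End control.

(* Main.v *)
(* The adjoint arc comes from a Lagrange multiplier rule on the whole half-line.
   Perturb the control by a bounded, compactly supported w and let h be the
   induced displacement of x, so that h' = J h + w e_n and h(0) = 0.  If the
   moments of w against 1, t, ..., t^(n-1) vanish, then h has compact support, so
   x + c h competes with x, and the convexity of F turns optimality into
   int <grad F(x), h> >= 0.  For any solution p0 of the adjoint equation this
   says int p0_n w <= 0.  Multipliers for the moment constraints are found one
   at a time, and yield a polynomial P of degree < n such that u maximizes
   v |-> (p0_n + P) v pointwise.  Qualification of the constraints means that no
   nonzero polynomial Q satisfies u in sgn(Q): otherwise u would be constant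
   between consecutive zeros of Q, hence on arbitrarily long intervals, and the
   last coordinate of x would be unbounded.  The last coordinate P of a solution
   of the homogeneous adjoint equation determines that solution, so p0 can be
   corrected into a lift.

   For the bounds, polynomial steering to the origin makes the optimal cost
   small near 0 and locally bounded, and the growth of F makes x dominated by the
   cost.  Next, p_n must vanish in every interval longer than twice the
   supremum of |x_n|, since u = +-1 where p_n <> 0.  Descending along
   p_k' = - p_(k-1) + d_k F(x), each p_k is small somewhere in every window of
   fixed length; ascending again from p_1, each p_k is small everywhere, in terms
   of sup |grad F(x)| only.  Applied on tails this gives p -> 0; two lifts differ
   by a polynomial arc tending to 0, so they coincide. *)
Require Import Defs.
From mathcomp Require Import all_boot all_order all_algebra.
From mathcomp Require Import all_classical all_reals all_analysis.
From mathcomp Require Import measurable_realfun.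
From mathcomp Require Import ring lra.
Import Order.TTheory GRing.Theory Num.Theory.
Set Implicit Arguments.
Unset Strict Implicit.
Unset Printing Implicit Defensive.
Import numFieldNormedType.Exports.
Local Open Scope classical_set_scope.
Local Open Scope ring_scope.

(** * Cousin's lemma: induction along a compact interval *)

Section cousin.
Context {R : realType}.

(** Let [c] range over the points with [Q a c]. The local property at the supremum of these points
    first reaches it and then crosses it, unless the supremum is [b]. *)
Lemma cousin_ind (a b : R) (Q : R -> R -> Prop) : a <= b ->
  (forall r s t, a <= r -> r <= s -> s <= t -> t <= b ->
     Q r s -> Q s t -> Q r t) ->
  (forall t, a <= t <= b -> exists2 d, 0 < d & forall r s,
     a <= r -> s <= b -> t - d < r -> r <= t -> t <= s -> s < t + d -> Q r s) ->
  Q a b.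
Proof.
move=> ab Qtrans Qloc.
pose S := [set c | [/\ a <= c, c <= b & Q a c]].
have Sa : S a.
  split => //; have [|d d0] := Qloc a; first by rewrite lexx.
  by apply => //; lra.
have supS : has_sup S.
  by split; [exists a | exists b => c []].
have ac : a <= sup S by apply: sup_upper_bound.
have cb : sup S <= b by apply: sup_le_ub => [|c []//]; exists a.
have [|d d0 Qd] := Qloc (sup S); first by rewrite ac.
have [c Sc cd] := sup_adherent d0 supS.
have cS : c <= sup S by apply: sup_upper_bound.
have [ac' cb' Qac] := Sc.
pose e := Num.min (sup S + d / 2) b.
have Se : sup S <= e by rewrite le_min; apply/andP; split => //; lra.
have eb : e <= b by rewrite ge_min lexx orbT.
have ed : e < sup S + d.
  by apply: (@le_lt_trans _ _ (sup S + d / 2)); [rewrite ge_min lexx | lra].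
have SSe : S e.
  split => //; first by lra.
  apply: (Qtrans a c e) => //; first by lra.
  by apply: Qd => //; lra.
have : e <= sup S by apply: sup_upper_bound.
rewrite {1}/e ge_min => /orP[|bS]; first by lra.
have -> : b = e by apply/eqP; rewrite eq_le eb andbT; lra.
by case: SSe.
Qed.

End cousin.

(** * Monotonicity of absolutely continuous functions from the sign of the derivative *)

Section absolute_continuity.
Context {R : realType}.
Let mu := @lebesgue_measure R.

(* Near a point of G the whole increment of f goes into the list s; near a point
   with derivative >= 0 the increment is at least -e times the length.  Cousin's
   lemma concatenates these local estimates. *)
Lemma ac_cover (f : R -> R) (a b e : R) (G : set R) : a <= b -> 0 < e ->
  open G ->
  (forall t, a <= t <= b -> G t \/ exists2 l, 0 <= l & is_derive t 1 f l) ->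
  exists s : seq (R * R),
    [/\ all (fun I => [&& a <= I.1, I.1 <= I.2 & I.2 <= b]) s,
        pairwise (fun I K => (I.2 <= K.1) || (K.2 <= I.1)) s,
        ((\sum_(I <- s) (I.2 - I.1))%:E <= mu (G `&` `]a, b]))%E &
        f b - f a >= - (\sum_(I <- s) `|f I.2 - f I.1|) - e * (b - a)].
Proof.
move=> ab e0 oG H.
have mG : measurable G by exact: open_measurable.
pose Q r t := exists s : seq (R * R),
    [/\ all (fun I => [&& r <= I.1, I.1 <= I.2 & I.2 <= t]) s,
        pairwise (fun I K => (I.2 <= K.1) || (K.2 <= I.1)) s,
        ((\sum_(I <- s) (I.2 - I.1))%:E <= mu (G `&` `]r, t]))%E &
        f t - f r >= - (\sum_(I <- s) `|f I.2 - f I.1|) - e * (t - r)].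
apply: (@cousin_ind _ a b Q) => //.
- move=> r s t _ rs st _ [l1 [A1 P1 L1 F1]] [l2 [A2 P2 L2 F2]].
  exists (l1 ++ l2); split.
  + rewrite all_cat; apply/andP; split.
      apply: sub_all A1 => I /and3P[-> ->] /= h; exact: le_trans st.
    by apply: sub_all A2 => I /and3P[h -> ->]; rewrite (le_trans rs).
  + rewrite pairwise_cat P1 P2 !andbT; apply/allrelP => I K I1 K2.
    move/allP/(_ _ I1)/and3P : A1 => [_ _ h1].
    by move/allP/(_ _ K2)/and3P : A2 => [h2 _ _]; rewrite (le_trans h1).
  + rewrite big_cat/= EFinD; apply: (le_trans (leeD L1 L2)).
    rewrite -measureU; last first.
    * apply/seteqP; split => // x /= [[_]]; rewrite !in_itv/= => /andP[_ h1].
      by case=> _ /andP[h2 _]; move: (lt_le_trans h2 h1); rewrite ltxx.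
    * by apply: measurableI => //; exact: measurable_itv.
    * by apply: measurableI => //; exact: measurable_itv.
    apply: le_measure; rewrite ?inE.
    * by apply: measurableU; apply: measurableI => //; exact: measurable_itv.
    * by apply: measurableI => //; exact: measurable_itv.
    move=> x /= [[Gx]|[Gx]]; rewrite !in_itv/= => /andP[h1 h2]; split => //.
      by rewrite h1 (le_trans h2).
    by rewrite h2 (le_lt_trans rs).
  + by rewrite big_cat/=; lra.
- move=> t /H [Gt|[l l0 fl]].
  + have /nbhs_ballP[d /= d0 dG] : nbhs t G by exact: open_nbhs_nbhs.
    exists d => // r s ar sb h1 rt ts h2.
    exists [:: (r, s)]; split => /=.
    * by rewrite lexx (le_trans rt ts) lexx.
    * by [].
    * rewrite big_seq1/=.
      rewrite (_ : G `&` `]r, s] = `]r, s]%classic).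
        rewrite [leRHS]lebesgue_measure_itv/= lte_fin.
        by case: ltP => // sr; rewrite lee_fin subr_le0.
      apply/setIidr => x /=; rewrite in_itv/= => /andP[rx xs].
      by apply: dG; rewrite /ball/= ltr_distl; lra.
    * rewrite big_seq1/=.
      have : - (e * (s - r)) <= 0 by rewrite oppr_le0 mulr_ge0 ?subr_ge0; lra.
      have := ler_norm (- (f s - f r)); rewrite normrN; lra.
  + case: fl => dfl fl.
    have : h^-1 *: (f (h *: (1 : R) + t) - f t) @[h --> 0^'] --> l.
      by rewrite -fl; exact: dfl.
    move/cvgrPdist_le => /(_ e e0) [/= d d0 dP].
    exists d => // r s ar sb h1 rt ts h2.
    (* The limit of the difference quotients, cleared of its denominator so that [h = 0] is
       covered. *)
    have key h : `|h| < d -> `|f (h + t) - f t - l * h| <= e * `|h|.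
      move=> hd; have [->|h0] := eqVneq h 0.
        by rewrite add0r mulr0 normr0 mulr0 subrr subr0 normr0.
      have := dP h; rewrite /= /ball/= sub0r normrN => /(_ hd h0).
      rewrite /GRing.scale/= mulr1.
      rewrite -(ler_pM2r (_ : 0 < `|h|)) ?normr_gt0// -normrM.
      rewrite -normrN; congr (`|_| <= _); field.
      exact: h0.
    exists [::]; split => //=.
      by rewrite big_nil measure_ge0.
    rewrite big_nil.
    have := key (r - t); rewrite subrK ler0_norm ?subr_le0// => /(_ ltac:(lra)).
    have := key (s - t); rewrite subrK ger0_norm ?subr_ge0// => /(_ ltac:(lra)).
    rewrite !ler_norml => /andP[k1 k2] /andP[k3 k4].
    have : 0 <= l * (s - t) by rewrite mulr_ge0 ?subr_ge0.
    have : 0 <= l * (t - r) by rewrite mulr_ge0 ?subr_ge0.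
    lra.
Qed.

(** The null set of bad points lies in an open set of measure less than [d]. By absolute continuity
    the increments over the list from [ac_cover] then add up to less than [e], which leaves no room
    for a decrease of [f]. *)
Lemma ac_nondecreasing (f : R -> R) (a b : R) : a <= b ->
  abs_continuous a b f ->
  {ae mu, forall t, a <= t <= b -> exists2 l, 0 <= l & is_derive t 1 f l} ->
  f a <= f b.
Proof.
move=> ab acf [E [mE E0 EP]].
rewrite -subr_ge0 leNgt; apply/negP => fab.
(* With this [e] the total error [e * (1 + (b - a))] is half of the supposed decrease. *)
pose e := (f a - f b) / (2 * (1 + (b - a))).
have e0 : 0 < e by rewrite divr_gt0 //; lra.
have [d d0 dP] := acf _ e0.
have [|G [oG EG Gd]] := @lebesgue_regularity_outer R E d mE _ d0.
  by rewrite [X in (X < _)%E]E0 ltry.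
have muG : (mu G < d%:E)%E.
  have mG : measurable G by exact: open_measurable.
  rewrite -(setDUK EG) (le_lt_trans (measureU2 _ _ _))//.
    exact: measurableD.
  by rewrite [X in (X + _ < _)%E]E0 add0e.
have [|s [s1 s2 s3 s4]] := @ac_cover f a b e G ab e0 oG.
  move=> t atb; have [Gt|nG] := pselect (G t); first by left.
  right; have : ~ E t by move=> /EG.
  by move=> nE; apply: contrapT => h; apply: nE; apply: EP => /= /(_ atb).
have : \sum_(I <- s) (I.2 - I.1) < d.
  rewrite -lte_fin (le_lt_trans s3)// (le_lt_trans _ muG)//.
  apply: le_measure; rewrite ?inE.
  - by apply: measurableI; [exact: open_measurable|exact: measurable_itv].
  - exact: open_measurable.
  - by move=> x [].
move=> /(dP s s1 s2) s5.
have : e * (1 + (b - a)) = (f a - f b) / 2.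
  by rewrite /e; field; lra.
rewrite mulrDr mulr1; lra.
Qed.

End absolute_continuity.

(** * Calculus of absolutely continuous primitives *)

Section primitives.
Context {R : realType}.
Let mu := @lebesgue_measure R.
Implicit Types (f g phi psi : R -> R) (a b T : R).

(** Stands for the identity of [f] with a constant plus the integral of [phi], but involves no
    integral, so that sums, products and comparisons reduce to pointwise derivatives. *)
Definition primitive (f phi : R -> R) : Prop :=
  abs_continuous_half_line f /\
  {ae lebesgue_measure, forall t : R, 0 <= t -> is_derive t 1 f (phi t)}.

Lemma abs_continuous_modulus (V : normedModType R) (f : R -> V) a b :
  abs_continuous a b f -> forall e, 0 < e -> exists2 d, 0 < d &
    forall s t, a <= s <= b -> a <= t <= b -> `|s - t| < d ->
      `|f s - f t| < e.
Proof.
move=> acf e e0; have [d d0 dP] := acf _ e0; exists d => //.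
have key s t : a <= s -> s <= t -> t <= b -> t - s < d -> `|f t - f s| < e.
  move=> as_ st tb std; have := dP [:: (s, t)]; rewrite /= !big_seq1/= andbT.
  by apply => //; rewrite as_ st tb.
move=> s t /andP[as_ sb] /andP[at_ tb]; case: (leP s t) => st h.
  rewrite distrC; apply: key => //.
  by rewrite -(@ger0_norm _ (t - s)) ?subr_ge0// distrC.
by apply: key => //; [exact: ltW | rewrite -(@ger0_norm _ (s - t)) ?subr_ge0// ltW].
Qed.

Lemma abs_continuous_within (V : normedModType R) (f : R -> V) a b :
  abs_continuous a b f -> {within `[a, b], continuous f}.
Proof.
move=> acf; apply/subspace_continuousP => t /= tab.
apply/cvgrPdist_lt => e e0.
have [d d0 dP] := abs_continuous_modulus acf e0.
rewrite near_withinE; exists d => //= s ts sab.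
by apply: dP => //; move: tab sab; rewrite !in_itv.
Qed.

Lemma half_line_within (V : normedModType R) (f : R -> V) a b :
  abs_continuous_half_line f -> 0 <= a -> {within `[a, b], continuous f}.
Proof.
move=> acf a0; have [ab|ba] := leP a b; last first.
  rewrite set_itv_ge ?bnd_simp; last by rewrite -ltNge.
  exact: continuous_subspace0.
have := abs_continuous_within (acf b (le_trans a0 ab)).
apply: continuous_subspaceW => t /=; rewrite !in_itv/= => /andP[h ->].
by rewrite (le_trans a0 h).
Qed.

Lemma half_line_bounded f T : abs_continuous_half_line f -> 0 <= T ->
  exists2 M, 0 < M & forall t, 0 <= t <= T -> `|f t| <= M.
Proof.
move=> acf T0; have cf := half_line_within (b := T) acf (lexx 0).
have [c1 _ h1] := EVT_max T0 cf.
have [c2 _ h2] := EVT_min T0 cf.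
exists (`|f c1| + `|f c2| + 1) => [|t tT].
  by rewrite ltr_wpDl// addr_ge0.
have := h1 t; have := h2 t; rewrite !in_itv/= => /(_ tT) k2 /(_ tT) k1.
have := ler_norm (f c1); have := ler_norm (- f c2); rewrite normrN => n2 n1.
have := normr_ge0 (f c1); have := normr_ge0 (f c2) => m1 m2.
by rewrite ler_norml; apply/andP; split; lra.
Qed.

(** The common source of absolute continuity for sums, products, scalar multiples and coordinates.
    The factor [M] is absorbed by asking for [e / (2 * M)] from both [f] and [g]. *)
Lemma abs_continuous_dominated (V W U : normedModType R) (f : R -> V)
    (g : R -> W) (h : R -> U) a b M : 0 < M ->
  abs_continuous a b f -> abs_continuous a b g ->
  (forall s t, a <= s -> s <= t -> t <= b ->
     `|h t - h s| <= M * (`|f t - f s| + `|g t - g s|)) ->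
  abs_continuous a b h.
Proof.
move=> M0 acf acg hM e e0.
have e2 : 0 < e / (2 * M) by rewrite divr_gt0// mulr_gt0.
have [d1 d10 h1] := acf _ e2; have [d2 d20 h2] := acg _ e2.
exists (Num.min d1 d2); first by rewrite lt_min d10.
move=> s s1 s2; rewrite lt_min => /andP[k1 k2].
apply: (@le_lt_trans _ _ (\sum_(I <- s) M * (`|f I.2 - f I.1| + `|g I.2 - g I.1|))).
  rewrite big_seq [leRHS]big_seq; apply: ler_sum => I sI.
  by move/allP: s1 => /(_ _ sI)/and3P[? ? ?]; exact: hM.
rewrite -mulr_sumr big_split/=.
have := h1 s s1 s2 k1; have := h2 s s1 s2 k2.
set x := \sum_(_ <- _) _; set y := \sum_(_ <- _) _ => hx hy.
have : M * (y + x) < M * (e / (2 * M) + e / (2 * M)).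
  by rewrite ltr_pM2l// ltrD.
suff -> : M * (e / (2 * M) + e / (2 * M)) = e by [].
by field; rewrite gt_eqF.
Qed.

Lemma abs_continuous_cst (V : normedModType R) (v : V) a b :
  abs_continuous a b (fun=> v).
Proof.
move=> e e0; exists 1 => // s _ _ _.
by rewrite big1// => I _; rewrite subrr normr0.
Qed.

Lemma abs_continuous_lip (V : normedModType R) (f : R -> V) a b M : 0 <= M ->
  (forall s t, a <= s -> s <= t -> t <= b -> `|f t - f s| <= M * (t - s)) ->
  abs_continuous a b f.
Proof.
move=> M0 lip e e0; exists (e / (M + 1)); first by rewrite divr_gt0// ltr_wpDl.
move=> s s1 s2 s3.
apply: (@le_lt_trans _ _ ((M + 1) * \sum_(I <- s) (I.2 - I.1))).
  rewrite mulr_sumr big_seq [leRHS]big_seq; apply: ler_sum => I sI.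
  move/allP: s1 => /(_ _ sI)/and3P[? h ?].
  by rewrite (le_trans (lip _ _ _ _ _))// ler_wpM2r ?subr_ge0// lerDl.
by rewrite mulrC -ltr_pdivlMr// ltr_wpDl.
Qed.

Lemma abs_continuousD (V : normedModType R) (f g : R -> V) a b :
  abs_continuous a b f -> abs_continuous a b g ->
  abs_continuous a b (fun t => f t + g t).
Proof.
move=> acf acg; apply: (@abs_continuous_dominated _ _ _ f g _ a b 1) => //.
by move=> s t _ _ _; rewrite mul1r opprD addrACA ler_normD.
Qed.

Lemma abs_continuousZ (V : normedModType R) (f : R -> R) (v : V) a b :
  abs_continuous a b f -> abs_continuous a b (fun t => f t *: v).
Proof.
move=> acf.
apply: (@abs_continuous_dominated _ _ _ f (fun=> v) _ a b (`|v| + 1)) => //.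
  exact: abs_continuous_cst.
move=> s t _ _ _; rewrite subrr normr0 addr0 -scalerBl normrZ mulrC.
by rewrite ler_wpM2r// lerDl.
Qed.

Lemma abs_continuousM f g a b : 0 <= a ->
  abs_continuous_half_line f -> abs_continuous_half_line g ->
  abs_continuous a b (fun t => f t * g t).
Proof.
move=> a0 acf acg; have [ab|ba] := leP a b; last first.
  apply: (@abs_continuous_lip _ _ _ _ 0) => // s t as_ st tb; lra.
have b0 : 0 <= b by lra.
have [M M0 fM] := half_line_bounded acf b0.
have [N N0 gN] := half_line_bounded acg b0.
have sub (h : R -> R) : abs_continuous_half_line h -> abs_continuous a b h.
  move=> /(_ b b0) ach e e0; have [d d0 dP] := ach e e0; exists d => // s s1 s2.
  apply: dP => //; apply: sub_all s1 => I /and3P[h1 -> ->].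
  by rewrite (le_trans a0 h1).
apply: (@abs_continuous_dominated _ _ _ f g _ a b (M + N)) => //.
- by rewrite addr_gt0.
- exact: sub.
- exact: sub.
move=> s t as_ st tb.
have -> : f t * g t - f s * g s = (f t - f s) * g t + f s * (g t - g s) by ring.
rewrite (le_trans (ler_normD _ _))// !normrM mulrDr lerD//.
  by rewrite mulrC ler_wpM2r// (le_trans (gN _ _)) ?lerDr ?(ltW M0)//; lra.
by rewrite ler_wpM2r// (le_trans (fM _ _)) ?lerDl ?(ltW N0)//; lra.
Qed.

Lemma ae_imply (P Q : R -> Prop) : (forall t, P t -> Q t) ->
  {ae mu, forall t, P t} -> {ae mu, forall t, Q t}.
Proof.
move=> PQ; apply: filterS; first exact: (ae_filter_ringOfSetsType mu).
by move=> t; exact: PQ.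
Qed.

Lemma ae_imply2 (P1 P2 Q : R -> Prop) : (forall t, P1 t -> P2 t -> Q t) ->
  {ae mu, forall t, P1 t} -> {ae mu, forall t, P2 t} -> {ae mu, forall t, Q t}.
Proof.
move=> PQ; apply: filterS2; first exact: (ae_filter_ringOfSetsType mu).
by move=> t; exact: PQ.
Qed.

(** Dropping the time 0 leaves times with a neighbourhood inside the half-line, where two-sided
    derivatives ignore the values at negative times. *)
Lemma ae_gt0 (P : R -> Prop) : (forall t, 0 < t -> P t) ->
  {ae mu, forall t, 0 <= t -> P t}.
Proof.
move=> h; exists [set 0]; split => //; first exact: lebesgue_measure_set1.
move=> t /= /not_implyP[t0 nP]; apply: contrapT => /eqP t1; apply: nP.
by apply: h; rewrite lt_neqAle eq_sym t1.
Qed.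

Lemma ae_ge0_forall (P : R -> Prop) : (forall t, 0 <= t -> P t) ->
  {ae mu, forall t, 0 <= t -> P t}.
Proof. by move=> h; apply: ae_gt0 => t /ltW; exact: h. Qed.

Lemma primitiveD f g phi psi : primitive f phi -> primitive g psi ->
  primitive (fun t => f t + g t) (fun t => phi t + psi t).
Proof.
move=> [acf df] [acg dg]; split.
  by move=> T T0; apply: abs_continuousD; [exact: acf|exact: acg].
apply: ae_imply2 df dg => t h1 h2 t0.
by have := is_deriveD (h1 t0) (h2 t0).
Qed.

Lemma primitive_cst c : primitive (fun=> c) (fun=> 0).
Proof.
split; first by move=> T _; exact: abs_continuous_cst.
by apply: ae_ge0_forall => t _; exact: is_derive_cst.
Qed.

Lemma primitiveM f g phi psi : primitive f phi -> primitive g psi ->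
  primitive (fun t => f t * g t) (fun t => phi t * g t + f t * psi t).
Proof.
move=> [acf df] [acg dg]; split.
  by move=> T T0; exact: abs_continuousM.
apply: ae_imply2 df dg => t h1 h2 t0.
have := is_deriveM (h1 t0) (h2 t0).
by rewrite addrC [_ *: _]mulrC.
Qed.

(** At [t > 0] the derivative depends only on values near [t], hence on nonnegative times. *)
Lemma eq_primitive f g phi psi : primitive f phi ->
  (forall t, 0 <= t -> f t = g t) ->
  {ae mu, forall t, 0 <= t -> phi t = psi t} -> primitive g psi.
Proof.
move=> [acf df] fg pp; split.
  move=> T T0 e e0; have [d d0 dP] := acf T T0 e e0; exists d => // s s1 s2 s3.
  rewrite (_ : \sum_(I <- s) _ = \sum_(I <- s) `|f I.2 - f I.1|); first exact: dP.
  rewrite big_seq [RHS]big_seq; apply: eq_bigr => I sI.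
  by move/allP: s1 => /(_ _ sI)/and3P[h1 h2 h3]; rewrite !fg//; lra.
have := ae_imply2 (fun t h1 h2 t0 => conj (h1 t0) (h2 t0)) df pp.
move=> {}df; apply: ae_imply2 (ae_gt0 (P := fun t => 0 < t) (fun t h => h)) df.
move=> t tgt /[swap] t0 /(_ t0)[h <-]; have {}tgt := tgt t0.
apply: near_eq_is_derive h; near=> z; apply: fg; apply: ltW.
by near: z; exact: lt_nbhsr.
Unshelve. all: by end_near. Qed.

Lemma primitiveZ c f phi : primitive f phi ->
  primitive (fun t => c * f t) (fun t => c * phi t).
Proof.
move=> pf; apply: (eq_primitive (primitiveM (primitive_cst c) pf)) => //.
by apply: ae_ge0_forall => s _; rewrite mul0r add0r.
Qed.

Lemma primitiveN f phi : primitive f phi ->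
  primitive (fun t => - f t) (fun t => - phi t).
Proof.
move=> /(primitiveZ (-1)) h; apply: eq_primitive h _ _.
  by move=> t _; rewrite mulN1r.
by apply: ae_ge0_forall => t _; rewrite mulN1r.
Qed.

Lemma primitiveB f g phi psi : primitive f phi -> primitive g psi ->
  primitive (fun t => f t - g t) (fun t => phi t - psi t).
Proof. by move=> pf /primitiveN; exact: primitiveD. Qed.

Lemma primitive_sum (I : Type) (s : seq I) (f phi : I -> R -> R) :
  (forall i, primitive (f i) (phi i)) ->
  primitive (fun t => \sum_(i <- s) f i t) (fun t => \sum_(i <- s) phi i t).
Proof.
move=> h; elim: s => [|i s ih].
  apply: (eq_primitive (primitive_cst 0)) => [t _|]; first by rewrite big_nil.
  by apply: ae_ge0_forall => t _; rewrite big_nil.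
apply: (eq_primitive (primitiveD (h i) ih)) => [t _|]; first by rewrite big_cons.
by apply: ae_ge0_forall => t _; rewrite big_cons.
Qed.

Lemma primitive_nondecreasing f phi a b : primitive f phi -> 0 <= a -> a <= b ->
  {ae mu, forall t, a <= t <= b -> 0 <= phi t} -> f a <= f b.
Proof.
move=> [acf df] a0 ab h; apply: ac_nondecreasing => //.
  move=> e e0; have [d d0 dP] := acf b (le_trans a0 ab) e e0; exists d => // s s1.
  apply: dP => //; apply: sub_all s1 => I /and3P[h1 -> ->].
  by rewrite (le_trans a0 h1).
apply: ae_imply2 df h => t h1 h2 /andP[h3 h4]; exists (phi t).
  by apply: h2; rewrite h3.
by apply: h1; rewrite (le_trans a0).
Qed.

Lemma primitive_id : primitive (fun t => t) (fun=> 1).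
Proof.
split; last by apply: ae_ge0_forall => t _; exact: is_derive_id.
move=> T _; apply: (@abs_continuous_lip _ _ _ _ 1) => // s t _ st _.
by rewrite mul1r ger0_norm// subr_ge0.
Qed.

(** Mean value inequality: the function [c * t - f t] has a nonnegative rate. *)
Lemma primitive_slope f phi a b c : primitive f phi -> 0 <= a -> a <= b ->
  {ae mu, forall t, a <= t <= b -> phi t <= c} -> f b - f a <= c * (b - a).
Proof.
move=> pf a0 ab h.
have := primitive_nondecreasing (primitiveB (primitiveZ c primitive_id) pf) a0 ab.
have hae : {ae mu, forall t : R, a <= t <= b -> 0 <= c * 1 - phi t}.
  by apply: ae_imply h => t /[apply]; rewrite mulr1 subr_ge0.
by move=> /(_ hae) /=; lra.
Qed.

Lemma primitive_slope_norm f phi a b c : primitive f phi -> 0 <= a -> a <= b ->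
  {ae mu, forall t, a <= t <= b -> `|phi t| <= c} ->
  `|f b - f a| <= c * (b - a).
Proof.
move=> pf a0 ab h; rewrite ler_norml; apply/andP; split.
  rewrite lerNl opprB.
  have := primitive_slope (primitiveN pf) a0 ab (c := c).
  rewrite opprK addrC; apply.
  by apply: ae_imply h => t /[apply]; rewrite ler_norml; lra.
apply: primitive_slope pf a0 ab _.
by apply: ae_imply h => t /[apply]; rewrite ler_norml; lra.
Qed.

(** The difference has rate 0 almost everywhere, so the mean value inequality with constant 0
    freezes it. *)
Lemma primitive_unique f g phi psi : primitive f phi -> primitive g psi ->
  {ae mu, forall t, 0 <= t -> phi t = psi t} ->
  f 0 = g 0 -> forall t, 0 <= t -> f t = g t.
Proof.
move=> pf pg h fg t t0.
have := @primitive_slope_norm _ _ 0 t 0 (primitiveB pf pg) (lexx _) t0.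
rewrite mul0r normr_le0 fg subrr subr0 subr_eq0 => /(_ _)/eqP; apply.
by apply: ae_imply h => s + /andP[s0 _] => ->//; rewrite subrr normr0.
Qed.

End primitives.

(** * Integrals of locally bounded functions as primitives *)

Section integral_primitive.
Context {R : realType}.
Let mu := @lebesgue_measure R.
Variable phi : R -> R.
Hypothesis mphi : measurable_fun (`[0, +oo[ : set R) phi.
Hypothesis bphi : forall T : R, 0 <= T ->
  exists M : R, forall t : R, 0 <= t <= T -> `|phi t| <= M.

Let itv_sub (b0 : bool) (a b : R) : 0 <= a ->
  [set` Interval (BSide b0 a) (BRight b)] `<=` (`[0, +oo[ : set R).
Proof.
move=> a0 x /=; rewrite !in_itv/= andbT; case: b0 => /= /andP[h _]; lra.
Qed.

Let int_integrable (b0 : bool) (a b : R) : 0 <= a ->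
  mu.-integrable [set` Interval (BSide b0 a) (BRight b)] (EFin \o phi).
Proof.
move=> a0; apply: measurable_bounded_integrable.
- exact: measurable_itv.
- rewrite [X in (X < _)%E]lebesgue_measure_itv/=; case: ifPn => // _.
  by rewrite -EFinB ltry.
- by apply: measurable_funS mphi; [exact: measurable_itv | exact: itv_sub].
- have [|M MP] := bphi (T := Num.max 0 b); first by rewrite le_max lexx.
  exists M; split; first exact: num_real.
  move=> N MN x xab; apply/ltW/(le_lt_trans _ MN)/MP.
  move: xab => /=; rewrite in_itv/= le_max; case: b0 => /= /andP[h1 h2];
    by apply/andP; split; [lra | rewrite h2 orbT].
Qed.

Let int0 t := \int[mu]_(s in `[0, t]) phi s.

Let int0_lip T : 0 <= T -> exists2 M, 0 <= M &
  forall s t, 0 <= s -> s <= t -> t <= T -> `|int0 t - int0 s| <= M * (t - s).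
Proof.
move=> T0; have [M MP] := bphi T0.
have M0 : 0 <= M by rewrite (le_trans _ (MP 0 _)) ?lexx.
exists M => // s t s0 st tT.
have I0 := int_integrable true t (lexx 0).
rewrite /int0 (Rintegral_itvB I0) ?bnd_simp//.
apply: (le_trans (le_normr_Rintegral _ _)) => //.
  exact: int_integrable.
have : \int[mu]_(x in `]s, t]) `|phi x| <= \int[mu]_(x in `]s, t]) M.
  apply: le_Rintegral => //.
  - by have := integrable_abse (int_integrable false t s0).
  - apply: measurable_bounded_integrable => //.
    + rewrite [X in (X < _)%E]lebesgue_measure_itv/=; case: ifPn => // _.
      by rewrite -EFinB ltry.
    + exists M; split; first exact: num_real.
      by move=> N MN x _ /=; rewrite ger0_norm// ltW.
  - by move=> x /=; rewrite in_itv/= => /andP[h1 h2]; apply: MP; lra.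
rewrite Rintegral_cst//.
have -> // : fine (mu `]s, t]) = t - s.
rewrite /mu lebesgue_measure_itv/= lte_fin; case: ltP => //= ts.
by apply/eqP; lra.
Qed.

Lemma primitive_integral : primitive (fun t => \int[mu]_(s in `[0, t]) phi s) phi.
Proof.
split.
  move=> T T0; have [M M0 MP] := int0_lip T0.
  by apply: (@abs_continuous_lip _ _ _ _ _ M).
(* Extension by 0 to negative times: the fundamental theorem of calculus is applied to a function
   locally integrable on the whole line. *)
pose psi := phi \_ `[0, +oo[.
have psiE t : 0 <= t -> psi t = phi t.
  by move=> t0; rewrite /psi patchE mem_set//= in_itv/= t0.
have psiN t : t < 0 -> psi t = 0.
  by move=> t0; rewrite /psi patchE memNset//= in_itv/= andbT; apply/negP; lra.
have mpsi : measurable_fun setT psi.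
  by apply/(measurable_restrictT _ _).1 => //; exact: measurable_itv.
have intE t : \int[mu]_(s in `[0, t]) phi s = \int[mu]_(s in `[0, t]) psi s.
  by apply: eq_Rintegral => s; rewrite inE/= in_itv/= => /andP[s0 _]; rewrite psiE.
have bpsi T : exists M, 0 <= M /\ forall t, t <= T -> `|psi t| <= M.
  have [|M MP] := bphi (T := Num.max 0 T); first by rewrite le_max lexx.
  have M0 : 0 <= M by rewrite (le_trans _ (MP 0 _)) ?lexx//= le_max lexx.
  exists M; split => // t tT; have [t0|t0] := leP 0 t.
    by rewrite psiE// MP// t0 le_max tT orbT.
  by rewrite psiN// normr0.
have := @FTC1 R psi (BLeft 0).
have h1 y : mu.-integrable [set` Interval (BLeft 0) (BRight y)] (EFin \o psi).
  apply: eq_integrable (int_integrable true y (lexx 0)) => //.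
  by move=> s; rewrite inE/= in_itv/= => /andP[s0 _]; rewrite /= psiE.
have h2 : locally_integrable setT psi.
  split => //; first exact: openT.
  move=> K _ cK.
  have [M [_ MP]] := compact_bounded cK.
  have [N [N0 NP]] := bpsi (`|M| + 1).
  have mK : measurable K by exact: compact_measurable.
  have mupsi : mu.-integrable K (EFin \o psi).
    apply: measurable_bounded_integrable => //.
    - exact: compact_finite_measure.
    - by apply: measurable_funS mpsi.
    - exists N; split; first exact: num_real.
      move=> N' NN' x Kx /=; rewrite (le_trans (NP _ _)) ?(ltW NN')//.
      apply: (le_trans (ler_norm _)); apply: MP => //.
      by rewrite (le_lt_trans (ler_norm _))// ltrDl.
  by case/integrableP : mupsi.
move=> /(_ h1 h2) h.
apply: ae_imply2 h (ae_gt0 (P := fun t => 0 < t) (fun t h => h)) => t hd t0P t0.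
have {}t0 := t0P t0.
have [|d1 d2] := hd.
  by have : 0 <= t by exact: ltW.
rewrite -(psiE t) ?ltW//.
rewrite (_ : (fun t0 : R => _) = fun y => \int[mu]_(s in `[0, y]) psi s).
  by split => //; rewrite -derive1E.
by apply/funext => y; rewrite intE.
Qed.

Lemma integral0_0 : \int[mu]_(s in `[0, 0]) phi s = 0.
Proof. by rewrite set_itv1 Rintegral_set1. Qed.

(** By uniqueness, any primitive [G] computes the integral up to [T]. The tail may be infinite,
    whence the extended reals. *)
Lemma integral_primitive_split (G : R -> R) T :
  (forall t, 0 <= t -> 0 <= phi t) -> primitive G phi -> 0 <= T ->
  (\int[mu]_(t in `[0%R, +oo[) (phi t)%:E =
   (G T - G 0)%:E + \int[mu]_(t in `]T, +oo[) (phi t)%:E)%E.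
Proof.
move=> phi0 pG T0.
have -> : [set` `[0, +oo[] = `[0, T]%classic `|` `]T, +oo[%classic :> set R.
  by rewrite (@itv_bndbnd_setU _ _ _ (BRight T)).
rewrite ge0_integral_setU//; first last.
- apply/disj_set2P/seteqP; split => // x /= [].
  by rewrite !in_itv/= andbT => /andP[_ h1 h2]; lra.
- by move=> x /= [|]; rewrite in_itv/= ?andbT => /= h; rewrite lee_fin phi0//; lra.
- apply/measurable_EFinP; apply: measurable_funS mphi => //.
  by move=> x /= []; rewrite !in_itv/= ?andbT => /= h; lra.
congr (_ + _)%E.
have -> : G T - G 0 = int0 T - int0 0.
  have := @primitive_unique _ (fun t => G t - G 0) int0 _ _
    (primitiveB pG (primitive_cst _)) primitive_integral.
  rewrite subrr /int0 integral0_0 subr0 => -> //.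
  by apply: ae_ge0_forall => t _; rewrite subr0.
rewrite /int0 integral0_0 subr0 /Rintegral fineK//.
exact: (integrable_fin_num _ (int_integrable true T (lexx 0))).
Qed.

End integral_primitive.

(** * Lagrange multipliers for affine constraints on a convex set *)

Section multipliers.
Context {R : realType} {E : lmodType R}.
Implicit Types (A : set E) (f g : E -> R).

Definition convex_on A := forall (a b : E) (h : R), A a -> A b -> 0 <= h <= 1 ->
  A (h *: a + (1 - h) *: b).

Definition affine_on A f := forall (a b : E) (h : R),
  A a -> A b -> 0 <= h <= 1 ->
  f (h *: a + (1 - h) *: b) = h * f a + (1 - h) * f b.

Lemma affine_onD A f g (c : R) : affine_on A f -> affine_on A g ->
  affine_on A (fun a => f a + c * g a).
Proof. by move=> Hf Hg a b h Aa Ab h01; rewrite Hf// Hg//; ring. Qed.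

(** If [g a > 0 > g b], then [f <= 0] at the point of the segment from [a] to [b] where [g]
    vanishes, which amounts to [f a / g a <= f b / g b]. A number between the two families of
    ratios, with its sign changed, is the multiplier. *)
Lemma one_multiplier A f g : convex_on A -> affine_on A f -> affine_on A g ->
  (exists2 a, A a & 0 < g a) -> (exists2 a, A a & g a < 0) ->
  (forall a, A a -> g a = 0 -> f a <= 0) ->
  exists c, forall a, A a -> f a + c * g a <= 0.
Proof.
move=> Aconv Hf Hg [a0 Aa0 ga0] [b0 Ab0 gb0] fg.
have key a b : A a -> A b -> 0 < g a -> g b < 0 -> f a / g a <= f b / g b.
  move=> Aa Ab ga gb.
  have d0 : 0 < g a - g b by lra.
  pose h := - g b / (g a - g b).
  have h01 : 0 <= h <= 1.
    apply/andP; split; first by rewrite divr_ge0//; lra.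
    by rewrite ler_pdivrMr//; lra.
  have e1 : h * g a + (1 - h) * g b = 0 by rewrite /h; field; lra.
  have := fg _ (Aconv _ _ _ Aa Ab h01); rewrite Hg// e1 => /(_ erefl).
  rewrite Hf// => h2.
  have : (h * f a + (1 - h) * f b) * (g a - g b) <= 0.
    by rewrite mulr_le0_ge0// ltW.
  have -> : (h * f a + (1 - h) * f b) * (g a - g b) = - g b * f a + g a * f b.
    by rewrite /h; field; lra.
  move=> h3; rewrite ler_pdivrMr// mulrAC ler_ndivlMr//; lra.
pose S := [set f a / g a | a in [set a | A a /\ 0 < g a]].
have supS : has_sup S.
  split; first by exists (f a0 / g a0), a0.
  by exists (f b0 / g b0) => _ [a [Aa ga] <-]; exact: key.
exists (- sup S) => a Aa; rewrite mulNr subr_le0.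
have [ga|ga|ga] := ltgtP 0 (g a).
- rewrite -ler_pdivrMr//; apply: sup_upper_bound => //.
  by exists a.
- rewrite -ler_ndivlMr//; apply: sup_le_ub; first by case: supS.
  by move=> _ [b [Ab gb] <-]; exact: key.
- by rewrite -ga mulr0 fg.
Qed.

(* The qualification hypothesis on g k only involves g 0, ..., g (k - 1), so that
   the multiplier of the last constraint can be split off by induction. *)
Lemma lagrange_multipliers A (g : nat -> E -> R) (m : nat) :
  convex_on A -> (forall k, (k < m)%N -> affine_on A (g k)) ->
  (forall (k : nat) (s : R) (c : nat -> R), (k < m)%N -> s != 0 ->
     exists2 a, A a & 0 < s * g k a + \sum_(j < k) c j * g j a) ->
  forall f, affine_on A f ->
  (forall a, A a -> (forall j, (j < m)%N -> g j a = 0) -> f a <= 0) ->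
  exists c : nat -> R, forall a, A a -> f a + \sum_(j < m) c j * g j a <= 0.
Proof.
move=> Aconv; elim: m => [|m ih] gaff gq f faff fg.
  exists (fun=> 0) => a Aa; rewrite big_ord0 addr0; exact: fg.
have gaffm k : (k < m)%N -> affine_on A (g k) by move=> km; apply: gaff; exact: ltnW.
have gqm k s (c : nat -> R) : (k < m)%N -> s != 0 ->
    exists2 a, A a & 0 < s * g k a + \sum_(j < k) c j * g j a.
  by move=> km; apply: gq; exact: ltnW.
have {}ih := ih gaffm gqm.
pose B := [set a | A a /\ forall j, (j < m)%N -> g j a = 0].
(* Were [s * g m] nonpositive on all of [B], the induction hypothesis with this objective would
   yield multipliers that contradict the qualification of [g m]. *)
have qual s : s != 0 -> exists2 a, B a & 0 < s * g m a.
  move=> s0; apply: contrapT => /forall2NP no.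
  have [||c cP] := ih (fun a => s * g m a).
  - by move=> a b h Aa Ab h01; rewrite gaff//; ring.
  - move=> a Aa ga; case: (no a) => [nB|/negP]; last by rewrite -leNgt.
    by exfalso; apply: nB.
  have [a Aa] := gq m s c (ltnSn m) s0.
  by rewrite ltNge cP.
(* The multiplier of the last constraint is found on [B], where the other constraints hold; the
   induction hypothesis then treats [f + c0 * g m] on all of [A]. *)
have [c0 c0P] : exists c0, forall a, B a -> f a + c0 * g m a <= 0.
  have affB h : affine_on A h -> affine_on B h.
    by move=> hA a b t [Aa _] [Ab _]; exact: hA.
  apply: one_multiplier.
  - move=> a b h [Aa ga] [Ab gb] h01; split; first exact: Aconv.
    by move=> j jm; rewrite gaffm// ga// gb// !mulr0 addr0.
  - exact: affB.
  - by apply: affB; exact: gaff.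
  - by have [|a Ba] := qual 1; rewrite ?oner_neq0// mul1r; exists a.
  - have [|a Ba] := qual (-1); rewrite ?oppr_eq0 ?oner_neq0// mulN1r oppr_gt0.
    by exists a.
  - move=> a [Aa ga] gm; apply: fg => // j; rewrite ltnS leq_eqVlt.
    by case/orP => [/eqP->//|]; exact: ga.
have [||c cP] := ih (fun a => f a + c0 * g m a).
- by apply: affine_onD => //; exact: gaff.
- by move=> a Aa ga; apply: c0P.
exists (fun j => if j == m then c0 else c j) => a Aa.
rewrite big_ord_recr/= eqxx; have := cP a Aa.
have -> : \sum_(j < m) (if j == m :> nat then c0 else c j) * g j a =
    \sum_(j < m) c j * g j a by apply: eq_bigr => j _; rewrite ltn_eqF.
lra.
Qed.

End multipliers.

(** * Max norm, scalar product and compact balls of column vectors *)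

Section column_vectors.
Context {R : realType} {n : nat}.
Implicit Types (x y h : 'cV[R]_n).

Definition dotp x y : R := \sum_(i < n) x i 0 * y i 0.

Lemma cV_norm_coord x i : `|x i 0| <= `|x|.
Proof.
rewrite [leRHS]/Num.Def.normr/= mx_normrE.
exact: (le_bigmax _ (fun ij : 'I_n * 'I_1 => `|x ij.1 ij.2|) (i, 0)).
Qed.

Lemma cV_norm_le x c : 0 <= c -> (forall i, `|x i 0| <= c) -> `|x| <= c.
Proof.
move=> c0 xc; rewrite [leLHS]/Num.Def.normr/= mx_normrE.
by apply: bigmax_le => // -[i j] _ /=; rewrite ord1.
Qed.

Lemma norm_trmx x : `|x^T| = `|x|.
Proof.
rewrite /Num.Def.normr/= !mx_normrE; apply/eqP; rewrite eq_le.
apply/andP; split; apply: bigmax_le => //; rewrite ?bigmax_ge_id//= => -[i j] _ /=.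
- rewrite mxE ord1.
  exact: (le_bigmax _ (fun ij : 'I_n * 'I_1 => `|x ij.1 ij.2|) (j, 0)).
- rewrite (ord1 j).
  have := le_bigmax 0 (fun ij : 'I_1 * 'I_n => `|x^T ij.1 ij.2|) (0, i).
  by rewrite /= mxE.
Qed.

(** Transposition is an isometry, so compactness is inherited from bounded closed sets of row
    vectors. *)
Lemma cV_ball_compact (r : R) : compact [set x : 'cV[R]_n | `|x| <= r].
Proof.
have -> : [set x : 'cV[R]_n | `|x| <= r] =
    (fun v : 'rV[R]_n => v^T) @` [set v | `|v| <= r].
  apply/seteqP; split=> [x /= xr|_ [v /= vr <-] /=].
    by exists x^T; rewrite ?trmxK//= norm_trmx.
  by rewrite -norm_trmx trmxK.
apply: continuous_compact.
  apply: continuous_subspaceT => v.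
  apply/(@cvgrPdist_lt _ _ _ (nbhs v) (nbhs_filter v)) => e e0.
  apply/nbhs_ballP; exists e => // w.
  by rewrite mx_norm_ball /ball_/= -linearB/= -norm_trmx trmxK.
apply: bounded_closed_compact.
  exists r; split; first exact: num_real.
  by move=> M rM v /= vr; rewrite (le_trans vr)// ltW.
have -> : [set v : 'rV[R]_n | `|v| <= r] = Num.norm @^-1` [set t | t <= r] by [].
by apply: (closed_comp (fun v _ => @norm_continuous _ _ v)); exact: closed_le.
Qed.

Lemma dotp_norm x y : `|dotp x y| <= n%:R * (`|x| * `|y|).
Proof.
apply: (le_trans (ler_norm_sum _ _ _)).
rewrite mulr_natl -[X in _ *+ X]card_ord -sumr_const.
by apply: ler_sum => i _; rewrite normrM ler_pM// cV_norm_coord.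
Qed.

Lemma dotpZr x y (c : R) : dotp x (c *: y) = c * dotp x y.
Proof. by rewrite /dotp mulr_sumr; apply: eq_bigr => i _; rewrite mxE; ring. Qed.

Lemma dotpBl x y h : dotp (x - y) h = dotp x h - dotp y h.
Proof.
by rewrite /dotp -sumrB; apply: eq_bigr => i _; rewrite !mxE; ring.
Qed.

End column_vectors.

Lemma continuous_cV_dist {R : realType} {n : nat} {V : normedModType R}
    (g : 'cV[R]_n -> V) (x : 'cV[R]_n) (e : R) : continuous g -> 0 < e ->
  exists2 d, 0 < d & forall y, `|x - y| < d -> `|g x - g y| < e.
Proof.
move=> /(_ x) cg e0.
have := @cvgr_dist_lt _ _ _ _ (nbhs_filter x) g _ cg e e0.
by move=> /nbhs_ballP[d /= d0 dP]; exists d => // y; move: (dP y); rewrite mx_norm_ball.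
Qed.

(** * Convexity, growth and local bounds of the running cost *)

Section running_cost.
Context {R : realType} {n : nat}.
Variable F : 'cV[R]_n.+1 -> R.
Hypotheses (F_C1 : continuously_differentiable F)
  (F_convex : strictly_convex F) (F_posdef : positive_definite F).
Implicit Types (x y h : 'cV[R]_n.+1).

Lemma cost_continuous : continuous F.
Proof. by move=> x; apply: differentiable_continuous; case: F_C1 => + _; exact. Qed.

Lemma cost_ge0 x : 0 <= F x.
Proof.
by have [->|x0] := eqVneq x 0; [rewrite F_posdef.1|rewrite ltW// F_posdef.2].
Qed.

Lemma derive_gradient x h : 'D_h F x = dotp (gradient F x) h.
Proof.
have dF : differentiable F x by case: F_C1.
rewrite deriveE// [in LHS](matrix_sum_delta h) linear_sum.
apply: eq_bigr => i _; rewrite big_ord1 linearZ/= mxE deriveE//.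
by rewrite mulrC.
Qed.

Lemma convex_le x y (a : R) : 0 <= a <= 1 ->
  F (a *: x + (1 - a) *: y) <= a * F x + (1 - a) * F y.
Proof.
move=> /andP[a0 a1]; have [->|xy] := eqVneq x y.
  by rewrite -scalerDl addrC subrK scale1r -mulrDl addrC subrK mul1r.
move: a0 a1; rewrite le_eqVlt => /predU1P[<-|a0].
  by rewrite subr0 scale0r add0r scale1r mul0r add0r mul1r.
rewrite le_eqVlt => /predU1P[->|a1].
  by rewrite subrr scale0r addr0 scale1r mul0r addr0 mul1r.
by rewrite ltW// F_convex// a0.
Qed.

(** By convexity the difference quotients of [F] along the segment from [x] to [y] are at most
    [F y - F x]; pass to the right limit at 0. *)
Lemma gradient_ineq x y : F y >= F x + dotp (gradient F x) (y - x).
Proof.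
rewrite -derive_gradient -lerBrDl; set h := y - x.
have dF : derivable F x h by apply: diff_derivable; case: F_C1.
have dF' : t^-1 *: (F (t *: h + x) - F x) @[t --> 0^'+] --> 'D_h F x.
  apply: cvg_trans dF; apply: cvg_app => A [e/= e0 eA].
  exists e => // t te t0; apply: eA => //.
  by rewrite gt_eqF.
apply: (cvgr_to_le dF').
near=> t.
have t0 : 0 < t by near: t; exact: nbhs_right_gt.
have t1 : t <= 1 by near: t; exact: nbhs_right_le.
rewrite /GRing.scale/= ler_pdivrMl//.
have -> : t *: h + x = t *: y + (1 - t) *: x.
  by rewrite /h scalerBr scalerBl scale1r -addrA; congr (_ + _); rewrite addrC.
have := @convex_le y x t; rewrite (ltW t0) t1 => /(_ isT).
lra.
Unshelve. all: by end_near. Qed.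

(** Since 0 minimizes [F], the derivatives at 0 are nonnegative in each direction and in its
    opposite. *)
Lemma gradient0 : gradient F 0 = 0.
Proof.
have F0 := F_posdef.1.
have dF h : 0 <= 'D_h F 0.
  have dF : derivable F 0 h by apply: diff_derivable; case: F_C1.
  have dF' : t^-1 *: (F (t *: h + 0) - F 0) @[t --> 0^'+] --> 'D_h F 0.
    apply: cvg_trans dF; apply: cvg_app => A [e/= e0 eA].
    exists e => // t te t0; apply: eA => //.
    by rewrite gt_eqF.
  apply: (cvgr_to_ge dF').
  near=> t.
  have t0 : 0 < t by near: t; exact: nbhs_right_gt.
  by rewrite F0 subr0 mulr_ge0 ?cost_ge0// invr_ge0 ltW.
apply/matrixP => i j; rewrite !mxE; apply/eqP; rewrite eq_le dF andbT.
have := dF (- delta_mx i 0).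
by rewrite !deriveE ?linearN ?oppr_ge0//; case: F_C1.
Unshelve. all: by end_near. Qed.

(** The constant is the minimum of [F] on the sphere of radius [r], divided by [r]. Convexity along
    the ray from 0, where [F] vanishes, makes [F] grow at least linearly beyond that sphere. *)
Lemma cost_growth (r : R) : 0 < r ->
  exists2 m, 0 < m & forall x, r <= `|x| -> m * `|x| <= F x.
Proof.
move=> r0.
pose S := [set x : 'cV[R]_n.+1 | `|x| = r].
have S0 : S !=set0.
  exists (const_mx r); apply/eqP; rewrite eq_le; apply/andP; split.
    by apply: cV_norm_le => [|i]; [exact: ltW | rewrite mxE gtr0_norm].
  by apply: le_trans (cV_norm_coord _ 0); rewrite mxE gtr0_norm.
have cS : compact S.
  apply: (subclosed_compact _ (@cV_ball_compact R n.+1 r)).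
    have -> : S = Num.norm @^-1` [set t | t = r] by [].
    by apply: (closed_comp (fun v _ => @norm_continuous _ _ v)); exact: closed_eq.
  by move=> x /= ->.
have [c cSc cmin] := compact_EVT_min S0 cS (continuous_subspaceT cost_continuous).
have Fc : 0 < F c.
  apply: F_posdef.2; apply/eqP => c0; move: cSc; rewrite c0 inE /S/= normr0.
  by move=> rE; move: r0; rewrite -rE ltxx.
exists (F c / r); first by rewrite divr_gt0.
move=> x rx.
have x0 : 0 < `|x| by exact: lt_le_trans rx.
have r1 : 0 <= r / `|x| <= 1.
  by rewrite ler_pdivrMr// mul1r rx andbT divr_ge0// ltW.
have := @convex_le x 0 _ r1; rewrite scaler0 addr0 F_posdef.1 mulr0 addr0 => h.
have := cmin ((r / `|x|) *: x).
rewrite inE /S/= normrZ gtr0_norm ?divr_gt0// divfK ?gt_eqF// => /(_ erefl) h2.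
rewrite mulrAC ler_pdivrMr//.
have := le_trans h2 h; rewrite mulrAC ler_pdivlMr//; lra.
Qed.

Lemma cost_gradient_bounded (r : R) : exists2 M, 0 < M &
  forall x, `|x| <= r -> F x <= M /\ `|gradient F x| <= M.
Proof.
have [r0|r0] := leP 0 r; last first.
  by exists 1 => // x xr; have := normr_ge0 x; lra.
have B0 : [set x : 'cV[R]_n.+1 | `|x| <= r] !=set0 by exists 0; rewrite /= normr0.
have cB := @cV_ball_compact R n.+1 r.
have [c1 _ h1] := compact_EVT_max B0 cB (continuous_subspaceT cost_continuous).
have cg : continuous (fun x => `|gradient F x|).
  by move=> x; have := F_C1.2 x => /cvg_norm.
have [c2 _ h2] := compact_EVT_max B0 cB (continuous_subspaceT cg).
exists (F c1 + `|gradient F c2| + 1) => [|x xr].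
  by rewrite ltr_wpDl// addr_ge0// cost_ge0.
have /= := h1 x; have /= := h2 x; rewrite !inE/= => /(_ xr) k2 /(_ xr) k1.
have := cost_ge0 c1; have := normr_ge0 (gradient F c2); split; lra.
Qed.

Lemma cost_gradient_small (e : R) : 0 < e -> exists2 d, 0 < d &
  forall x, `|x| <= d -> F x <= e /\ `|gradient F x| <= e.
Proof.
move=> e0.
have [d1 d10 h1] := continuous_cV_dist 0 cost_continuous e0.
have [d2 d20 h2] := continuous_cV_dist 0 F_C1.2 e0.
exists (Num.min d1 d2 / 2) => [|x].
  by rewrite divr_gt0// lt_min d10.
rewrite ler_pdivlMr// le_min => /andP[k1 k2].
have x0 : `|x| < d1 /\ `|x| < d2.
  by have := normr_ge0 x; rewrite le_eqVlt => /predU1P[<-|]; split; lra.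
move: (h1 x) (h2 x).
rewrite F_posdef.1 gradient0 !sub0r !normrN ger0_norm ?cost_ge0//.
by move=> l1 l2; split; apply: ltW; [apply: l1|apply: l2]; case: x0.
Qed.

(** Heine's theorem through near coverings. Only [x] is confined to the ball, so a perturbed state
    [y] may leave it. *)
Lemma gradient_unif_continuous (r e : R) : 0 < e -> exists2 d, 0 < d &
  forall x y, `|x| <= r -> `|x - y| < d -> `|gradient F x - gradient F y| < e.
Proof.
move=> e0.
have := (compact_near_coveringP _).1 (@cV_ball_compact R n.+1 r) R (0^'+)
  (fun d x => forall y, `|x - y| < d -> `|gradient F x - gradient F y| < e) _.
move=> /(_ _)[|d /= d0 dP].
  move=> x _.
  have e2 : 0 < e / 2 by rewrite divr_gt0.
  have [d d0 dP] := continuous_cV_dist x F_C1.2 e2.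
  exists (ball x (d / 2), [set t | t < d / 2]).
    split => /=; first by apply: nbhsx_ballx; rewrite divr_gt0.
    by apply: nbhs_right_lt; rewrite divr_gt0.
  move=> [z t] /= [xz td] y zy.
  have xz' : `|x - z| < d / 2 by move: xz; rewrite mx_norm_ball.
  have k1 := dP z; have k2 := dP y.
  have {}k1 : `|gradient F x - gradient F z| < e / 2 by apply: k1; lra.
  have {}k2 : `|gradient F x - gradient F y| < e / 2.
    apply: k2; rewrite -(subrKA z) (le_lt_trans (ler_normD _ _))//; lra.
  rewrite -(subrKA (gradient F x)) (le_lt_trans (ler_normD _ _))//.
  rewrite [`|gradient F z - _|]distrC; lra.
exists (d / 2) => [|x y xr xy]; first by rewrite divr_gt0.
apply: (dP (d / 2)) => //=; last by rewrite divr_gt0.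
by rewrite sub0r normrN gtr0_norm ?divr_gt0//; lra.
Qed.

End running_cost.

(** * Vector-valued primitives *)

Section vector_primitives.
Context {R : realType}.
Let mu := @lebesgue_measure R.

Definition vprimitive (m : nat) (x phi : R -> 'cV[R]_m) : Prop :=
  abs_continuous_half_line x /\
  {ae lebesgue_measure, forall t : R, 0 <= t -> is_derive t 1 x (phi t)}.

Lemma is_derive_coord (m : nat) (x : R -> 'cV[R]_m) (v : 'cV[R]_m) (t : R) :
  is_derive t 1 x v <-> forall i, is_derive t 1 (fun s => x s i 0) (v i 0).
Proof.
split=> [[dx <-] i|h].
  split; first by move/derivable_mxP : dx; exact.
  by rewrite derive_mx// mxE.
have dx : derivable x t 1.
  by apply/derivable_mxP => i j; rewrite ord1; case: (h i).
split=> //; apply/matrixP => i j; rewrite derive_mx// mxE ord1.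
by case: (h i).
Qed.

Lemma ae_forall_fin (I : finType) (P : I -> R -> Prop) :
  (forall i, {ae mu, forall t, P i t}) -> {ae mu, forall t, forall i, P i t}.
Proof.
move=> h; apply: (@filter_forall _ _ _ _ (ae_filter_ringOfSetsType mu)).
exact: h.
Qed.

Lemma vprimitiveP (m : nat) (x phi : R -> 'cV[R]_m) : vprimitive x phi <->
  forall i, primitive (fun t => x t i 0) (fun t => phi t i 0).
Proof.
split=> [[acx dx] i|h].
  split.
    move=> T T0; apply: (abs_continuous_dominated (f := x) (g := fun=> 0 : R) ltr01).
    - exact: acx.
    - exact: abs_continuous_cst.
    move=> s t _ _ _; rewrite subrr normr0 addr0 mul1r.
    by apply: le_trans (cV_norm_coord _ i); rewrite !mxE.
  by apply: ae_imply dx => t /[apply]/is_derive_coord.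
split.
  move=> T T0.
  (* Expansion in the canonical basis, which reduces absolute continuity to the coordinates. *)
  have -> : x = fun t => \sum_(i < m) x t i 0 *: (delta_mx i 0 : 'cV[R]_m).
    apply/funext => t; rewrite [LHS]matrix_sum_delta; apply: eq_bigr => i _.
    by rewrite big_ord1.
  elim: (index_enum _) => [|i s ih].
    under eq_fun do rewrite big_nil.
    exact: abs_continuous_cst.
  under eq_fun do rewrite big_cons.
  have [/(_ T T0) aci _] := h i.
  exact: (abs_continuousD (abs_continuousZ (delta_mx i 0) aci) ih).
have {}h i : {ae mu, forall t : R, 0 <= t ->
    is_derive t 1 (fun t => x t i 0) (phi t i 0)} by case: (h i).
apply: ae_imply (ae_forall_fin h) => t ht t0.
by apply/is_derive_coord => i; exact: ht.
Qed.

Lemma eq_vprimitive (m : nat) (x y phi psi : R -> 'cV[R]_m) : vprimitive x phi ->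
  (forall t, 0 <= t -> x t = y t) ->
  {ae mu, forall t, 0 <= t -> phi t = psi t} -> vprimitive y psi.
Proof.
move=> /vprimitiveP h xy pp; apply/vprimitiveP => i.
apply: (eq_primitive (h i)) => [t t0|]; first by rewrite xy.
by apply: ae_imply pp => t /[apply] ->.
Qed.

Lemma vprimitive_lin (m : nat) (x y phi psi : R -> 'cV[R]_m) (e : R) :
  vprimitive x phi -> vprimitive y psi ->
  vprimitive (fun t => x t + e *: y t) (fun t => phi t + e *: psi t).
Proof.
move=> /vprimitiveP hx /vprimitiveP hy; apply/vprimitiveP => i.
apply: (eq_primitive (primitiveD (hx i) (primitiveZ e (hy i)))) => [t _|].
  by rewrite !mxE.
by apply: ae_ge0_forall => t _; rewrite !mxE.
Qed.

Lemma vprimitive_dotp (m : nat) (p h phi psi : R -> 'cV[R]_m) :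
  vprimitive p phi -> vprimitive h psi ->
  primitive (fun t => dotp (p t) (h t))
            (fun t => dotp (phi t) (h t) + dotp (p t) (psi t)).
Proof.
move=> /vprimitiveP hp /vprimitiveP hh.
apply: (eq_primitive (primitive_sum (index_enum _)
  (fun i => primitiveM (hp i) (hh i)))) => //.
by apply: ae_ge0_forall => t _; rewrite big_split.
Qed.

End vector_primitives.

(** * The chain of integrators and its adjoint in coordinates *)

Section integrator_chain.
Context {R : realType} {n : nat}.
Implicit Types (x p g h : R -> 'cV[R]_n.+1) (v w : R -> R).
Let mu := @lebesgue_measure R.
Local Notation J := (jordan0 R n.+1).
Local Notation e := (elast R n).

Lemma dotp_mulmx (a b : 'cV[R]_n.+1) : dotp a b = (a^T *m b) 0 0.
Proof. by rewrite mxE; apply: eq_bigr => i _; rewrite mxE. Qed.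

Lemma dotp_elast (a : 'cV[R]_n.+1) : dotp a e = a ord_max 0.
Proof.
rewrite /dotp (bigD1 ord_max)//= big1 => [|i im].
  by rewrite mxE !eqxx mulr1 addr0.
by rewrite mxE (negbTE im) mulr0.
Qed.

(** The terms in [J] cancel by transposition. This duality trades the action of [w] against the last
    coordinate of [p] for the action of [h] against [g]. *)
Lemma adjoint_product p g h w :
  vprimitive p (fun t => - J^T *m p t + g t) ->
  vprimitive h (fun t => J *m h t + w t *: e) ->
  primitive (fun t => dotp (p t) (h t))
            (fun t => dotp (g t) (h t) + p t ord_max 0 * w t).
Proof.
move=> hp hh; apply: (eq_primitive (vprimitive_dotp hp hh)) => //.
apply: ae_ge0_forall => t _; rewrite -[p t _ _]dotp_elast !dotp_mulmx.
have -> : (- J^T *m p t + g t)^T *m h t =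
    (g t)^T *m h t - (p t)^T *m (J *m h t).
  by rewrite linearD/= mulNmx linearN/= trmx_mul trmxK mulmxDl mulNmx mulmxA addrC.
rewrite mulmxDr -scalemxAr.
set a := _ *m _; set b := _ *m _; set c := _ *m _.
by rewrite [(a - b) 0 0]mxE [(b + _) 0 0]mxE [(- b) 0 0]mxE [(_ *: c) 0 0]mxE; ring.
Qed.

Lemma jordan0_coord (a : 'cV[R]_n.+1) (w : R) (i : 'I_n.+1) :
  (J *m a + w *: e) i 0 = if i == n :> nat then w else a (inord i.+1) 0.
Proof.
rewrite !mxE andbT; have [im|im] := eqVneq (i : nat) n.
  rewrite big1 => [|j _]; last first.
    rewrite mxE; case: eqP => [ji|]; last by rewrite mul0r.
    by have := ltn_ord j; rewrite ji im ltnn.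
  have -> : i == ord_max by apply/eqP/val_inj.
  by rewrite add0r mulr1.
have iltn : (i < n)%N by rewrite ltn_neqAle im -ltnS ltn_ord.
have -> : (i == ord_max) = false by apply/negbTE; apply: contra im => /eqP ->.
rewrite mulr0 addr0 (bigD1 (inord i.+1))//= big1 => [|j ji].
  by rewrite mxE inordK// eqxx mul1r addr0.
rewrite mxE; case: eqP => [jE|]; last by rewrite mul0r.
by case/eqP: ji; apply/val_inj; rewrite /= inordK.
Qed.

Lemma jordan0_tr_coord (a b : 'cV[R]_n.+1) (i : 'I_n.+1) :
  (- J^T *m a + b) i 0 =
  (if i == 0 :> nat then 0 else - a (inord i.-1) 0) + b i 0.
Proof.
rewrite mulNmx !mxE; congr (_ + _); have [i0|i0] := eqVneq (i : nat) 0.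
  by rewrite big1 ?oppr0// => j _; rewrite !mxE i0 mul0r.
have i1 : (i.-1 < n.+1)%N by rewrite (leq_ltn_trans (leq_pred _)).
congr (- _); rewrite (bigD1 (inord i.-1))//= big1 => [|j ji].
  by rewrite !mxE inordK// prednK ?lt0n// eqxx mul1r addr0.
rewrite !mxE; case: eqP => [jE|]; last by rewrite mul0r.
by case/eqP: ji; apply/val_inj; rewrite /= jE/= inordK// -jE.
Qed.

Lemma chain_coordP h w :
  vprimitive h (fun t => J *m h t + w t *: e) <->
  (forall k, (k < n)%N ->
     primitive (fun t => h t (inord k) 0) (fun t => h t (inord k.+1) 0)) /\
  primitive (fun t => h t ord_max 0) w.
Proof.
split=> [/vprimitiveP H|[H1 H2]].
  split=> [k kn|].
    apply: (eq_primitive (H (inord k))) => //; apply: ae_ge0_forall => t _.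
    by rewrite jordan0_coord inordK ?ltnS 1?ltnW// ltn_eqF.
  apply: (eq_primitive (H ord_max)) => //; apply: ae_ge0_forall => t _.
  by rewrite jordan0_coord eqxx.
apply/vprimitiveP => i; have [im|im] := eqVneq (i : nat) n.
  have -> : i = ord_max by apply/val_inj.
  apply: (eq_primitive H2) => //; apply: ae_ge0_forall => t _.
  by rewrite jordan0_coord eqxx.
have iltn : (i < n)%N by rewrite ltn_neqAle im -ltnS ltn_ord.
have := H1 _ iltn; rewrite inord_val => H; apply: (eq_primitive H) => //.
by apply: ae_ge0_forall => t _; rewrite jordan0_coord (negbTE im).
Qed.

Lemma adjoint_coordP p g :
  vprimitive p (fun t => - J^T *m p t + g t) <->
  primitive (fun t => p t 0 0) (fun t => g t 0 0) /\
  (forall k, (k < n)%N -> primitive (fun t => p t (inord k.+1) 0)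
      (fun t => - p t (inord k) 0 + g t (inord k.+1) 0)).
Proof.
split=> [/vprimitiveP H|[H1 H2]].
  split=> [|k kn].
    apply: (eq_primitive (H 0)) => //; apply: ae_ge0_forall => t _.
    by rewrite jordan0_tr_coord eqxx add0r.
  apply: (eq_primitive (H (inord k.+1))) => //; apply: ae_ge0_forall => t _.
  by rewrite jordan0_tr_coord inordK.
apply/vprimitiveP => i; have [i0|i0] := eqVneq (i : nat) 0.
  have -> : i = 0 by apply/val_inj.
  apply: (eq_primitive H1) => //; apply: ae_ge0_forall => t _.
  by rewrite jordan0_tr_coord eqxx add0r.
have iltn : (i.-1 < n)%N by rewrite prednK ?lt0n// -ltnS.
have := H2 _ iltn; rewrite prednK ?lt0n// inord_val => H.
apply: (eq_primitive H) => //.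
by apply: ae_ge0_forall => t _; rewrite jordan0_tr_coord (negbTE i0).
Qed.

End integrator_chain.

(** * Locally bounded measurable integrands and polynomials *)

Section locally_bounded.
Context {R : realType}.
Let mu := @lebesgue_measure R.
Implicit Types (f g phi psi : R -> R).

(** A class closed under sums and products, containing the absolutely continuous functions, on which
    [integral0] yields primitives. *)
Definition locally_bounded_measurable phi : Prop :=
  measurable_fun (`[0, +oo[ : set R) phi /\
  forall T : R, 0 <= T -> exists M : R, forall t : R, 0 <= t <= T -> `|phi t| <= M.

Lemma lbm_continuous f :
  (forall T : R, 0 <= T -> {within `[0, T], continuous f}) ->
  locally_bounded_measurable f.
Proof.
move=> cf; split.
  apply: subspace_continuous_measurable_fun; first exact: measurable_itv.
  apply/subspace_continuousP => t /=; rewrite in_itv/= andbT => t0.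
  (* The interval up to [t + 1] contains all nonnegative times within 1 of [t], hence the minimum
     with 1 below. *)
  have /subspace_continuousP/(_ t) := cf (t + 1) ltac:(lra).
  rewrite /= in_itv/= t0 => /(_ ltac:(lra)) ct.
  apply/cvgrPdist_lt => e e0; move/cvgrPdist_lt : ct => /(_ e e0).
  rewrite !near_withinE => -[d /= d0 dP].
  exists (Num.min d 1) => /=; first by rewrite lt_min d0 ltr01.
  move=> s /=; rewrite lt_min => /andP[s1 s2]; rewrite in_itv/= andbT => s0.
  apply: dP => //=; rewrite in_itv/= s0/=.
  by move: s2; rewrite distrC ltr_norml => /andP[]; lra.
move=> T T0.
have [c1 _ h1] := EVT_max T0 (cf T T0).
have [c2 _ h2] := EVT_min T0 (cf T T0).
exists (`|f c1| + `|f c2|) => t tT.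
have := h1 t; have := h2 t; rewrite !in_itv/= => /(_ tT) k2 /(_ tT) k1.
have := ler_norm (f c1); have := ler_norm (- f c2); rewrite normrN => n2 n1.
have := normr_ge0 (f c1); have := normr_ge0 (f c2) => m1 m2.
by rewrite ler_norml; apply/andP; split; lra.
Qed.

Lemma lbm_ac f : abs_continuous_half_line f -> locally_bounded_measurable f.
Proof. by move=> acf; apply: lbm_continuous => T T0; exact: half_line_within. Qed.

Lemma lbm_primitive f phi : primitive f phi -> locally_bounded_measurable f.
Proof. by case=> /lbm_ac. Qed.

Lemma lbmD f g : locally_bounded_measurable f -> locally_bounded_measurable g ->
  locally_bounded_measurable (fun t => f t + g t).
Proof.
move=> [mf bf] [mg bg]; split; first exact: measurable_funD.
move=> T T0; have [M MP] := bf T T0; have [N NP] := bg T T0.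
exists (M + N) => t tT; apply: (le_trans (ler_normD _ _)).
by apply: lerD; [exact: MP | exact: NP].
Qed.

Lemma lbmM f g : locally_bounded_measurable f -> locally_bounded_measurable g ->
  locally_bounded_measurable (fun t => f t * g t).
Proof.
move=> [mf bf] [mg bg]; split; first exact: measurable_funM.
move=> T T0; have [M MP] := bf T T0; have [N NP] := bg T T0.
by exists (M * N) => t tT; rewrite normrM ler_pM// ?MP ?NP.
Qed.

Lemma lbm_cst c : locally_bounded_measurable (fun=> c).
Proof. by split; [exact: measurable_cst | move=> T T0; exists `|c|]. Qed.

Lemma lbmN f : locally_bounded_measurable f ->
  locally_bounded_measurable (fun t => - f t).
Proof.
move=> /(lbmM (lbm_cst (-1))); congr locally_bounded_measurable.
by apply/funext => t; rewrite mulN1r.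
Qed.

Definition integral0 phi t : R := \int[mu]_(s in `[0, t]) phi s.

Lemma integral0P phi : locally_bounded_measurable phi ->
  primitive (integral0 phi) phi.
Proof. by move=> [? ?]; exact: primitive_integral. Qed.

Lemma integral00 phi : integral0 phi 0 = 0.
Proof. exact: integral0_0. Qed.

Lemma primitive_horner (P : {poly R}) :
  primitive (horner P) (horner P^`()).
Proof.
elim/poly_ind: P => [|P c ih].
  apply: (eq_primitive (primitive_cst 0)) => [t _|]; first by rewrite horner0.
  by apply: ae_ge0_forall => t _; rewrite deriv0 horner0.
apply: (eq_primitive (primitiveD (primitiveM ih primitive_id) (primitive_cst c))).
  by move=> t _; rewrite !hornerE.
by apply: ae_ge0_forall => t _; rewrite derivD derivM derivX derivC !hornerE.
Qed.

End locally_bounded.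

(** * Existence of trajectories and adjoint arcs; polynomial arcs *)

Section chain_existence.
Context {R : realType} {n : nat}.
Local Notation J := (jordan0 R n.+1).
Local Notation e := (elast R n).

(** Coordinate [i] is the integral of [w] iterated [n.+1 - i] times. *)
Lemma chain_exists (w : R -> R) : locally_bounded_measurable w ->
  exists h : R -> 'cV[R]_n.+1, h 0 = 0 /\
    vprimitive h (fun t => J *m h t + w t *: e).
Proof.
move=> bw; pose A k := iter k integral0 w.
have bA k : locally_bounded_measurable (A k).
  by elim: k => [//|k ih]; apply: lbm_primitive (integral0P ih).
exists (fun t => \col_i A (n.+1 - i)%N t); split.
  apply/matrixP => i j; rewrite !mxE subSn ?leq_ord//=; exact: integral00.
apply/chain_coordP; split=> [k kn|].
  apply: (eq_primitive (integral0P (bA (n - k)%N))) => [t _|].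
    by rewrite mxE inordK ?ltnS 1?ltnW// subSn 1?ltnW.
  by apply: ae_ge0_forall => t _; rewrite mxE inordK.
apply: (eq_primitive (integral0P bw)) => [t _|]; first by rewrite mxE subSnn.
exact: ae_ge0_forall.
Qed.

(** The coordinates are integrated from the first to the last, each one feeding the next. *)
Lemma adjoint_exists (g : R -> 'cV[R]_n.+1) :
  (forall i, locally_bounded_measurable (fun t => g t i 0)) ->
  exists p : R -> 'cV[R]_n.+1, vprimitive p (fun t => - J^T *m p t + g t).
Proof.
move=> bg.
pose B := fix B k := integral0 (fun t =>
  (if k is k'.+1 then - B k' t else 0) + g t (inord k) 0).
have BS k : B k.+1 = integral0 (fun t => - B k t + g t (inord k.+1) 0) by [].
have bB k : locally_bounded_measurable (B k).
  elim: k => [|k ih]; [|rewrite BS]; apply: (lbm_primitive (integral0P _)).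
    by apply: lbmD => //; exact: lbm_cst.
  by apply: lbmD => //; exact: lbmN.
exists (fun t => \col_i B i t); apply/adjoint_coordP; split=> [|k kn].
  apply: (eq_primitive (@integral0P _ (fun t => 0 + g t (inord 0) 0) _)) => //.
  - by apply: lbmD => //; exact: lbm_cst.
  - by move=> t _; rewrite mxE.
  apply: ae_ge0_forall => t _; rewrite add0r; congr (g t _ 0).
  by apply/val_inj; rewrite /= inordK.
apply: (eq_primitive (@integral0P _ (fun t => - B k t + g t (inord k.+1) 0) _)) => //.
- by apply: lbmD => //; exact: lbmN.
- by move=> t _; rewrite mxE inordK.
by apply: ae_ge0_forall => t _; rewrite mxE inordK// ltnS ltnW.
Qed.

(* The solution of the homogeneous adjoint equation with last coordinate P, when
   P has degree at most n. *)
Definition poly_arc (P : {poly R}) (t : R) : 'cV[R]_n.+1 :=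
  \col_i ((-1) ^+ (n - i) * (P^`(n - i)).[t]).

Lemma poly_arc_last P t : poly_arc P t ord_max 0 = P.[t].
Proof. by rewrite mxE subnn mul1r. Qed.

(** Going down one coordinate costs one derivative and one sign; the chain stops at the first
    coordinate because [P] has degree at most [n]. *)
Lemma poly_arcP (P : {poly R}) : (size P <= n.+1)%N ->
  vprimitive (poly_arc P) (fun t => - J^T *m poly_arc P t + 0).
Proof.
move=> sP; apply/adjoint_coordP; split=> [|k kn].
  apply: (eq_primitive (primitiveZ ((-1) ^+ n) (primitive_horner P^`(n)))).
    by move=> t _; rewrite mxE subn0.
  apply: ae_ge0_forall => t _; rewrite mxE -derivnS derivn_poly0// horner0.
  by rewrite mulr0.
apply: (eq_primitive (primitiveZ ((-1) ^+ (n - k.+1)%N)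
  (primitive_horner P^`(n - k.+1)%N))).
  by move=> t _; rewrite mxE inordK.
apply: ae_ge0_forall => t _; rewrite !mxE !inordK ?ltnS 1?ltnW// addr0 -derivnS.
by rewrite -[in RHS](subnSK kn) exprS; ring.
Qed.

End chain_existence.

(** * Zeros of the switching function and bounds on sliding windows *)

Section windows.
Context {R : realType}.
Let mu := @lebesgue_measure R.
Implicit Types (q g phi xi u : R -> R) (a b c E W : R).

Lemma constant_sign q a b : a <= b -> {within `[a, b], continuous q} ->
  (forall t, a <= t <= b -> q t != 0) ->
  (forall t, a <= t <= b -> 0 < q t) \/ (forall t, a <= t <= b -> q t < 0).
Proof.
move=> ab cq q0.
have sub s t : a <= s -> s <= t -> t <= b -> {within `[s, t], continuous q}.
  move=> as_ st tb; apply: continuous_subspaceW cq => r /=; rewrite !in_itv/=.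
  by move=> /andP[h1 h2]; apply/andP; split; lra.
have key s t : a <= s -> s <= t -> t <= b -> 0 <= q s * q t.
  move=> as_ st tb; rewrite leNgt; apply/negP => qst.
  have [|c] := IVT st (sub s t as_ st tb) (v := 0).
    rewrite ge_min le_max; have [qs|qs] := leP (q s) 0.
      by rewrite orTb/=; apply/orP; right; nra.
    by apply/andP; split; apply/orP; [right; nra | left; lra].
  rewrite in_itv/= => /andP[h1 h2] /eqP; apply/negP/q0; lra.
have aab : a <= a <= b by rewrite lexx.
have [qa|qa|qa] := ltgtP 0 (q a); last by move: (q0 a aab); rewrite -qa eqxx.
- left=> t /[dup] tab /andP[at_ tb]; rewrite lt_neqAle eq_sym q0//=.
  by have := key a t (lexx _) at_ tb; rewrite pmulr_rge0.
- right=> t /[dup] tab /andP[at_ tb]; rewrite lt_neqAle q0//=.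
  by have := key a t (lexx _) at_ tb; rewrite nmulr_rge0.
Qed.

Lemma set_sgn_pos c v : 0 < c -> set_sgn c v -> v = 1.
Proof.
by move=> c0; rewrite /set_sgn gt_eqF//= => ->; rewrite gtr0_norm// divff ?gt_eqF.
Qed.

Lemma set_sgn_neg c v : c < 0 -> set_sgn c v -> v = -1.
Proof.
move=> c0; rewrite /set_sgn lt_eqF//= => ->.
by rewrite ltr0_norm// invrN mulrN divff ?lt_eqF.
Qed.

(** Where [q] has no zero its sign is constant, so [xi] moves monotonically at unit speed. *)
Lemma bang_arc xi u q a b : 0 <= a -> a <= b -> primitive xi u ->
  {within `[a, b], continuous q} ->
  {ae mu, forall t : R, 0 <= t -> set_sgn (q t) (u t)} ->
  (forall t, a <= t <= b -> q t != 0) -> b - a <= `|xi b - xi a|.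
Proof.
move=> a0 ab hx cq hu q0; have [qpos|qneg] := constant_sign ab cq q0.
- have := primitive_slope (primitiveN hx) a0 ab (c := -1).
  rewrite mulN1r => h; apply: le_trans (ler_norm _).
  rewrite -lerN2; apply: le_trans (h _); first by rewrite opprB opprK addrC.
  apply: ae_imply hu => t ht tab; rewrite lerN2.
  rewrite (set_sgn_pos (qpos t tab) (ht _))//; lra.
- have := primitive_slope hx a0 ab (c := -1).
  rewrite mulN1r => h; rewrite -normrN; apply: le_trans (ler_norm _).
  rewrite -lerN2 opprK; apply: h.
  apply: ae_imply hu => t ht tab.
  rewrite (set_sgn_neg (qneg t tab) (ht _))//; lra.
Qed.

(** Without a zero, [xi] would travel at least [2 * M + 1], more than the bound [M] allows. *)
Lemma zero_in_window xi u q (t0 M : R) : 0 <= t0 -> primitive xi u ->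
  abs_continuous_half_line q ->
  {ae mu, forall t : R, 0 <= t -> set_sgn (q t) (u t)} ->
  (forall t, t0 <= t -> `|xi t| <= M) ->
  forall t, t0 <= t -> exists2 s, t <= s <= t + (2 * M + 1) & q s = 0.
Proof.
move=> t00 hx acq hu xM t t0t; have M0 := le_trans (normr_ge0 _) (xM t t0t).
apply: contrapT => /forall2NP no.
have t1 : t <= t + (2 * M + 1) by lra.
have := bang_arc (le_trans t00 t0t) t1 hx
  (half_line_within acq (le_trans t00 t0t)) hu.
have q0 s : t <= s <= t + (2 * M + 1) -> q s != 0.
  by move=> ts; apply/eqP; case: (no s).
move=> /(_ q0); rewrite addrAC subrr add0r.
have := ler_normB (xi (t + (2 * M + 1))) (xi t).
have := xM t t0t; have := xM (t + (2 * M + 1)) (le_trans t0t t1).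
lra.
Qed.

Definition small_points q (t0 c W : R) :=
  forall t, t0 <= t -> exists2 s, t <= s <= t + W & `|q s| <= c.

(** Here [q'] is the next coordinate, not a derivative. Take points where it is small in the first
    and last thirds of the window. If the absolute value of [q] exceeded the new bound all the way
    between them, [q] would keep its sign and [q'] would move at speed at least [2 * c + d] for a
    time at least 1, whereas its two values differ by at most [2 * c]. *)
Lemma small_points_step q (q' : R -> R) g (t0 c W d : R) : 0 <= t0 -> 0 <= c -> 0 < d -> 1 <= W ->
  abs_continuous_half_line q -> primitive q' (fun t => - q t + g t) ->
  (forall t, t0 <= t -> `|g t| <= d) ->
  small_points q' t0 c W -> small_points q t0 (2 * c + 2 * d) (3 * W).
Proof.
move=> t00 c0 d0 W1 acq pq gd sp t t0t.
have [s1 /andP[s1a s1b] q1] := sp t t0t.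
have [|s2 /andP[s2a s2b] q2] := sp (t + 2 * W); first lra.
apply: contrapT => /forall2NP no.
have s12 : s1 <= s2 by lra.
have big s : s1 <= s <= s2 -> 2 * c + 2 * d < `|q s|.
  move=> ss; rewrite ltNge; apply/negP; case: (no s) => // h; exfalso; apply: h; lra.
have q0 s : s1 <= s <= s2 -> q s != 0.
  by move=> /big h; rewrite -normr_gt0; lra.
have s10 : 0 <= s1 by lra.
have Wp : (2 * c + d) * 1 <= (2 * c + d) * (s2 - s1).
  by rewrite ler_wpM2l; lra.
move: q1 q2; rewrite !ler_norml => /andP[k1 k2] /andP[k3 k4].
have gd' s : s1 <= s <= s2 -> - d <= g s <= d.
  by move=> ss; rewrite -ler_norml; apply: gd; lra.
have [qpos|qneg] := constant_sign s12 (half_line_within acq s10) q0.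
- have := primitive_slope pq s10 s12 (c := - (2 * c + d)).
  suff h : {ae mu, forall t, s1 <= t <= s2 -> - q t + g t <= - (2 * c + d)}.
    by move=> /(_ h); lra.
  apply: aeW => s ss; have := big s ss; rewrite gtr0_norm ?qpos//.
  by have := gd' s ss; lra.
- have := primitive_slope (primitiveN pq) s10 s12 (c := - (2 * c + d)).
  suff h : {ae mu, forall t, s1 <= t <= s2 -> - (- q t + g t) <= - (2 * c + d)}.
    by move=> /(_ h); lra.
  apply: aeW => s ss; have := big s ss; rewrite ltr0_norm ?qneg//.
  by have := gd' s ss; lra.
Qed.

(** Mean value inequality from [t] to the next small point, at most [W] later. *)
Lemma small_points_bound (f : R -> R) phi (t0 c W d : R) : 0 <= t0 -> 0 <= d -> primitive f phi ->
  (forall t, t0 <= t -> `|phi t| <= d) -> small_points f t0 c W ->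
  forall t, t0 <= t -> `|f t| <= c + d * W.
Proof.
move=> t00 d0 pf phid sp t t0t; have [s /andP[ts sW] fs] := sp t t0t.
have := primitive_slope_norm pf (le_trans t00 t0t) ts (c := d).
have h1 : {ae mu, forall r, t <= r <= s -> `|phi r| <= d}.
  by apply: aeW => r /andP[tr _]; apply: phid; exact: le_trans tr.
move=> /(_ h1) h.
have : d * (s - t) <= d * W by rewrite ler_wpM2l//; lra.
have := ler_normB (f s) (f s - f t); rewrite opprB addrC subrK; lra.
Qed.

(* E j and W j control the j-th coordinate from the last one: it is at most
   E j * d somewhere in each window of length W j. *)
Lemma window_bound (m : nat) (L : R) : 1 <= L -> exists2 K : R, 0 < K &
  forall (q g : nat -> R -> R) (t0 d : R), 0 <= t0 -> 0 < d ->
  primitive (q 0) (g 0) ->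
  (forall k, (k < m)%N -> primitive (q k.+1) (fun t => - q k t + g k.+1 t)) ->
  (forall k t, (k <= m)%N -> t0 <= t -> `|g k t| <= d) ->
  (forall t, t0 <= t -> exists2 s, t <= s <= t + L & q m s = 0) ->
  forall k t, (k <= m)%N -> t0 <= t -> `|q k t| <= K * d.
Proof.
move=> L1.
pose E j : R := iter j (fun c => 2 * c + 2) 0.
pose W j : R := iter j (fun c => 3 * c) L.
have E0 j : 0 <= E j by elim: j => [|j ih] //=; rewrite addr_ge0// mulr_ge0.
have W1 j : 1 <= W j by elim: j => [|j ih] //=; lra.
(* [B k] bounds coordinate [k] at all times, in units of [d]: the value at a small point plus the
   window length times the rate, which is at most 1 for the first coordinate and [B k' + 1] for the
   others. *)
pose B := fix B k : R :=
  E (m - k)%N + (if k is k'.+1 then B k' + 1 else 1) * W (m - k)%N.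
have B0 k : 0 < B k.
  elim: k => [|k ih]; rewrite [B _]/=.
    by have := E0 (m - 0)%N; have := W1 (m - 0)%N; lra.
  rewrite ltr_wpDl// mulr_gt0 ?addr_gt0//; exact: lt_le_trans (W1 _).
exists (\sum_(k < m.+1) B k).
  rewrite big_ord_recl ltr_pwDl// sumr_ge0// => i _; exact: ltW.
move=> q g t0 d t00 d0 p0 pS gd qm.
have acq k : (k <= m)%N -> abs_continuous_half_line (q k).
  by case: k => [_|k km]; [case: p0|case: (pS k km)].
have sp j : (j <= m)%N -> small_points (q (m - j)%N) t0 (E j * d) (W j).
  elim: j => [_|j ih jm].
    move=> t t0t; have [s ts qs] := qm t t0t; exists s => //.
    by rewrite subn0 qs normr0 mul0r.
  have pq := pS (m - j.+1)%N; rewrite -subSn// subSS in pq.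
  have {}pq := pq (leq_subr _ _).
  have := small_points_step t00 (mulr_ge0 (E0 j) (ltW d0)) d0 (W1 j) _ pq.
  have -> : E j.+1 * d = 2 * (E j * d) + 2 * d by rewrite /=; ring.
  apply.
  - by apply: acq; exact: leq_subr.
  - by move=> t t0t; apply: gd => //; exact: leq_subr.
  - by apply: ih; exact: ltnW.
have bd k : (k <= m)%N -> forall t, t0 <= t -> `|q k t| <= B k * d.
  elim: k => [_|k ih km] t t0t.
    have := small_points_bound t00 (ltW d0) p0 (fun t => gd 0 t (leq0n m)).
    move=> /(_ _ _ _ _ t0t); have := sp m (leqnn m); rewrite subnn => /[swap] h.
    move=> /h /le_trans; apply; rewrite [B _]/= subn0 mul1r mulrDl.
    by rewrite [d * _]mulrC.
  have h1 s : t0 <= s -> `|- q k s + g k.+1 s| <= (B k + 1) * d.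
    move=> t0s; rewrite (le_trans (ler_normD _ _))// normrN mulrDl mul1r lerD//.
      by apply: ih => //; exact: ltnW.
    exact: gd.
  have Bd : 0 <= (B k + 1) * d by rewrite mulr_ge0 ?addr_ge0// ltW.
  have := small_points_bound t00 Bd (pS k km) h1.
  move=> /(_ _ _ _ _ t0t); have := sp (m - k.+1)%N (leq_subr _ _).
  rewrite subKn// => /[swap] h /h /le_trans; apply.
  by rewrite [B k.+1]/=; lra.
move=> k t km t0t; apply: (le_trans (bd k km t t0t)).
apply: ler_wpM2r; first exact: ltW.
rewrite (bigD1 (Ordinal (n := m.+1) km))//= lerDl sumr_ge0// => i _; exact: ltW.
Qed.

End windows.

(** * Steering polynomials *)

Section steering_polynomial.
Context {R : realType}.
Implicit Types (P Q : {poly R}).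

Lemma horner_le_sum P (s : R) : 0 <= s <= 1 ->
  `|P.[s]| <= \sum_(i < size P) `|P`_i|.
Proof.
move=> /andP[s0 s1]; rewrite horner_coef (le_trans (ler_norm_sum _ _ _))//.
apply: ler_sum => i _; rewrite normrM [`|s ^+ _|]ger0_norm ?exprn_ge0//.
by rewrite ler_piMr// exprn_ile1.
Qed.

(** Each derivative removes at most one factor from the power. *)
Lemma dvdp_exp_derivn (c : R) m i P :
  (('X - c%:P) ^+ (m + i) %| P)%R -> (('X - c%:P) ^+ m %| P^`(i))%R.
Proof.
elim: i m => [|i ih] m; first by rewrite addn0 derivn0.
rewrite addnS -addSn => /ih /dvdpP[q]; rewrite derivnS => ->.
rewrite derivM deriv_exp /= derivXsubC mul1r exprS mulrA.
by apply: dvdp_add; [exact: dvdp_mull | rewrite mulrnAr -mulr_natl mulrA dvdp_mull].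
Qed.

Lemma derivn_scale (c : R) P i :
  (P \Po (c *: 'X))^`(i) = c ^+ i *: (P^`(i) \Po (c *: 'X)).
Proof.
elim: i => [|i ih]; first by rewrite !derivn0 expr0 scale1r.
rewrite !derivnS ih derivZ deriv_comp derivZ derivX.
by rewrite -scalerAr mulr1 scalerA exprSr.
Qed.

(** Bezout's identity for the coprime powers of ['X] and ['X - 1]: [Q] agrees with 1 at 0 and with 0
    at 1, both to order [N]. *)
Lemma smooth_cutoff (N : nat) : exists Q A B : {poly R},
  Q = 1 - A * 'X^N /\ Q = B * ('X - 1%:P) ^+ N.
Proof.
have : coprimep ('X^N : {poly R}) (('X - 1%:P) ^+ N).
  apply: coprimep_expl; apply: coprimep_expr.
  have : coprimep ('X - 0%:P : {poly R}) ('X - 1%:P).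
    by rewrite coprimep_XsubC2// subr0 oner_neq0.
  by rewrite subr0.
move=> /Bezout_eq1_coprimepP[[a b] /= ab].
by exists (b * ('X - 1%:P) ^+ N), a, b; split => //; rewrite -ab addrAC subrr add0r.
Qed.

(* A Taylor polynomial times a cut-off steers on [0, 1] with a control linear in
   the state.  The dilation by l = 1 + K |x0| divides the state by at least l and
   leaves the size of the control unchanged, which makes it at most 1. *)
Lemma steering_poly (n : nat) : exists2 K : R, 0 < K &
  forall x0 : 'cV[R]_n.+1, exists P : {poly R},
  [/\ forall i : 'I_n.+1, P^`(i).[0] = x0 i 0,
      forall i : 'I_n.+1, P^`(i).[1 + K * `|x0|] = 0 &
      forall (i : nat) t, (i <= n.+1)%N -> 0 <= t <= 1 + K * `|x0| ->
        `|P^`(i).[t]| <= (1 + K * `|x0|) ^+ (n.+1 - i) *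
                         (K * `|x0| / (1 + K * `|x0|))].
Proof.
have [Q [A [B [QA QB]]]] := smooth_cutoff n.+1.
(* Taylor monomial of degree [k], cut off so as to vanish to order [n + 1] at 1. *)
pose q k := Q * ((k`!)%:R^-1 *: 'X^k).
pose S k i := \sum_(j < size (q k)^`(i)) `|(q k)^`(i)`_j|.
have S0 k i : 0 <= S k i by apply: sumr_ge0.
(* [S k i] dominates the [i]-th derivative of [q k] on the unit interval; [K] exceeds the sum of
   these bounds over all coordinates and all orders up to [n + 1]. *)
pose K := 1 + \sum_(k < n.+1) \sum_(i < n.+2) S k i.
have K0 : 0 < K.
  by rewrite ltr_wpDr// sumr_ge0// => k _; rewrite sumr_ge0.
exists K => // x0; set l := 1 + K * `|x0|.
have l1 : 1 <= l by rewrite lerDl mulr_ge0// ltW.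
have l0 : 0 < l by exact: lt_le_trans l1.
(* Initial coordinate [k] in the dilated scale, compensating the power of [l] that the [k]-th
   derivative of [P] acquires. *)
pose z k := x0 (inord k) 0 * (l ^+ (n.+1 - k))^-1.
pose Z := \sum_(k < n.+1) z k *: q k.
pose P := l ^+ n.+1 *: (Z \Po (l^-1 *: 'X)).
have PE (i : nat) t : (i <= n.+1)%N ->
    P^`(i).[t] = l ^+ (n.+1 - i) * Z^`(i).[t / l].
  move=> ni; rewrite derivnZ derivn_scale !hornerZ horner_comp hornerZ hornerX.
  rewrite mulrA [l^-1 * t]mulrC; congr (_ * _).
  by rewrite -[in LHS](subnK ni) exprD -mulrA exprVn divff ?mulr1// expf_neq0// gt_eqF.
exists P; split.
- move=> i; rewrite PE 1?ltnW// mul0r.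
  (* Modulo ['X^n.+1] the cut-off is 1, so the low coefficients of [Z] are those of the Taylor
     polynomial. *)
  have -> : Z = (\sum_(k < n.+1) (z k / (k`!)%:R) *: 'X^k)
      - (\sum_(k < n.+1) (z k / (k`!)%:R) *: 'X^k) * A * 'X^(n.+1).
    rewrite -mulrA -[X in X - _]mulr1 -mulrBr -QA mulr_suml.
    apply: eq_bigr => k _.
    by rewrite /q -scalerAr scalerA [Q * _]mulrC scalerAl.
  rewrite horner_coef0 coef_derivn addn0 coefB coefMXn ltn_ord subr0.
  rewrite coef_sum (bigD1 i)//= big1 => [|k ki]; last first.
    by rewrite coefZ coefXn eq_sym (inj_eq val_inj) (negbTE ki) mulr0.
  rewrite coefZ coefXn eqxx mulr1 addr0 ffactnn -[z i / _ *+ _]mulr_natr divfK; last first.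
    by rewrite pnatr_eq0 -lt0n fact_gt0.
  by rewrite /z inord_val mulrC divfK// expf_neq0// gt_eqF.
- move=> i; rewrite PE 1?ltnW// divff ?gt_eqF//.
  suff /rootP -> : root Z^`(i) 1 by rewrite mulr0.
  rewrite root_factor_theorem -[X in X %| _]expr1.
  apply: dvdp_exp_derivn.
  have -> : Z = (\sum_(k < n.+1) (z k / (k`!)%:R) *: 'X^k) * Q.
    rewrite mulr_suml.
    apply: eq_bigr => k _.
    by rewrite /q -scalerAr scalerA [Q * _]mulrC scalerAl.
  rewrite QB; apply: dvdp_mull; apply: dvdp_mull.
  by apply: dvdp_exp2l; rewrite add1n ltn_ord.
- move=> i t ni t01; rewrite PE// normrM.
  have ln0 : 0 <= l ^+ (n.+1 - i) by rewrite exprn_ge0// ltW.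
  rewrite [`|l ^+ _|]ger0_norm//; apply: ler_wpM2l => //.
  have t1 : 0 <= t / l <= 1.
    case/andP: t01 => h1 h2; rewrite ler_pdivrMr// mul1r h2 andbT.
    by rewrite divr_ge0// ltW.
  have -> : Z^`(i).[t / l] = \sum_(k < n.+1) z k * ((q k)^`(i)).[t / l].
    rewrite /Z linear_sum horner_sum; apply: eq_bigr => k _.
    by rewrite linearZ hornerZ.
  apply: (le_trans (ler_norm_sum _ _ _)).
  apply: (@le_trans _ _ (\sum_(k < n.+1) `|x0| / l * S k i)).
    apply: ler_sum => k _; rewrite normrM ler_pM//; last exact: horner_le_sum.
    rewrite /z normrM ler_pM// ?cV_norm_coord//.
    rewrite normfV ger0_norm; last by rewrite exprn_ge0// ltW.
    rewrite lef_pV2 ?posrE ?exprn_gt0//.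
    by rewrite -[leLHS]expr1 ler_weXn2l// subn_gt0 ltn_ord.
  rewrite -mulr_sumr (_ : K * `|x0| / l = `|x0| / l * K); last by ring.
  apply: ler_wpM2l; first by rewrite divr_ge0// ltW.
  apply: (@le_trans _ _ (\sum_(k < n.+1) \sum_(i < n.+2) S k i)); last first.
    by rewrite /K lerDr.
  apply: ler_sum => k _.
  by rewrite (bigD1 (Ordinal (n := n.+2) (m := i) ni))//= lerDl sumr_ge0.
Qed.

End steering_polynomial.

(** * Truncation of a primitive at a zero *)

Section truncation.
Context {R : realType}.
Let mu := @lebesgue_measure R.

Lemma ae_neq (l : R) (P : R -> Prop) : (forall t, t != l -> P t) ->
  {ae mu, forall t, P t}.
Proof.
move=> h; exists [set l]; split => //; first exact: lebesgue_measure_set1.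
by move=> t /= nP; apply: contrapT => /eqP t1; apply: nP; exact: h.
Qed.

(** The bound on [phi] makes the truncation Lipschitz across [l], where [f] vanishes; the only new
    point where the derivative may fail is [l]. *)
Lemma primitive_truncate (f phi : R -> R) (l M : R) : 0 < l ->
  primitive f phi -> f l = 0 -> (forall t, 0 <= t <= l -> `|phi t| <= M) ->
  primitive (fun t => if t < l then f t else 0)
            (fun t => if t < l then phi t else 0).
Proof.
move=> l0 pf fl phiM.
have M0 : 0 <= M by rewrite (le_trans (normr_ge0 _) (phiM 0 _))// lexx ltW.
have lip s t : 0 <= s -> s <= t -> t <= l -> `|f t - f s| <= M * (t - s).
  move=> s0 st tl; apply: (primitive_slope_norm pf s0 st).
  by apply: aeW => r /andP[sr rt]; apply: phiM; lra.
split.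
  move=> T T0; apply: (@abs_continuous_lip _ _ _ _ _ M) => // s t s0 st tT.
  case: ltP => tl.
    by rewrite (le_lt_trans st tl); apply: lip => //; exact: ltW.
  case: ltP => sl; last first.
    by rewrite subrr normr0 mulr_ge0// subr_ge0.
  rewrite -fl; apply: (le_trans (lip s l s0 (ltW sl) (lexx _))).
  by rewrite ler_wpM2l//; lra.
have [_ dfae] := pf.
apply: (ae_imply2 _ (ae_neq (l := l) (fun t h => h)) dfae) => t tl df t0.
have [lt|lt] := ltP t l.
  apply: near_eq_is_derive (df t0); near=> z.
  by rewrite ifT//; near: z; exact: lt_nbhsl.
apply: near_eq_is_derive (is_derive_cst 0 t 1); near=> z.
rewrite ifF//; apply/negbTE; rewrite -leNgt ltW//; near: z; apply: lt_nbhsr.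
by rewrite lt_neqAle eq_sym tl.
Unshelve. all: by end_near. Qed.

End truncation.

(** * Steering to the origin by admissible controls *)

Section steering.
Context {R : realType} {n : nat}.
Local Notation J := (jordan0 R n.+1).
Local Notation e := (elast R n).

(** The state consists of the derivatives of the steering polynomial and the control is its
    derivative of order [n + 1]; both are continued by 0 from the time when all coordinates
    vanish. *)
Lemma steering : exists2 K : R, 0 < K & forall x0 : 'cV[R]_n.+1,
  exists u (y : R -> 'cV[R]_n.+1),
  [/\ admissible_control u, trajectory x0 u y,
      forall t, 0 <= t -> `|y t| <= (1 + K * `|x0|) ^+ n * (K * `|x0|) &
      forall t, 1 + K * `|x0| <= t -> y t = 0].
Proof.
have [K K0 KP] := @steering_poly R n; exists K => // x0.
have [P [P0 Pl PM]] := KP x0; set l := 1 + K * `|x0| in Pl PM *.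
have Kx : 0 <= K * `|x0| by rewrite mulr_ge0// ltW.
have l1 : 1 <= l by rewrite lerDl.
have l0 : 0 < l by exact: lt_le_trans l1.
pose u t := if t < l then P^`(n.+1).[t] else 0.
pose y t : 'cV[R]_n.+1 := \col_i (if t < l then P^`(i).[t] else 0).
have prim i : (i < n.+1)%N ->
    primitive (fun t => if t < l then P^`(i).[t] else 0)
              (fun t => if t < l then P^`(i.+1).[t] else 0).
  move=> i_n; apply: (primitive_truncate l0 _ (Pl (Ordinal i_n))).
    rewrite derivnS; exact: primitive_horner.
  by move=> t; exact: PM.
exists u, y; split.
- split.
    apply: measurable_funTS; apply: measurable_fun_ifT => //.
    + exact: measurable_fun_ltr.
    + exact: (continuous_measurable_fun (@continuous_horner _ _)).
  apply: ae_ge0_forall => t t0; rewrite /u; case: ltP => tl; last by lra.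
  rewrite -ler_norml; apply: le_trans (PM _ _ (leqnn _) _) _.
    by rewrite t0 ltW.
  by rewrite subnn expr0 mul1r ler_pdivrMr// mul1r lerDr.
- have [] : y 0 = x0 /\ vprimitive y (fun t => J *m y t + u t *: e).
    split.
      by apply/matrixP => i j; rewrite mxE l0 P0 (ord1 j).
    apply/chain_coordP; split=> [k kn|].
      apply: (eq_primitive (prim k _)) => //; first by rewrite ltnS ltnW.
        by move=> t _; rewrite mxE inordK// ltnS ltnW.
      by apply: ae_ge0_forall => t _; rewrite mxE inordK.
    apply: (eq_primitive (prim n _)) => //; first by move=> t _; rewrite mxE.
    exact: ae_ge0_forall.
  by move=> y0 [acy dy]; split.
- move=> t t0; apply: cV_norm_le => [|i].
    by rewrite mulr_ge0// exprn_ge0// ltW.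
  rewrite mxE; case: ltP => tl; last first.
    by rewrite normr0 mulr_ge0// exprn_ge0// ltW.
  apply: le_trans (PM i t _ _) _; first by rewrite ltnW.
    by rewrite t0 ltW.
  rewrite mulrCA mulrC; apply: ler_wpM2r => //.
  rewrite ler_pdivrMr// -exprSr ler_weXn2l//; exact: leq_subr.
- move=> t lt; apply/matrixP => i j; rewrite !mxE ifF//.
  by apply/negbTE; rewrite -leNgt.
Qed.

End steering.

(** * Cost of a trajectory over finite and infinite time *)

Section trajectory_cost.
Context {R : realType} {n : nat}.
Variable F : 'cV[R]_n.+1 -> R.
Hypotheses (F_C1 : continuously_differentiable F)
  (F_convex : strictly_convex F) (F_posdef : positive_definite F).
Implicit Types (x y : R -> 'cV[R]_n.+1).
Let mu := @lebesgue_measure R.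
Local Notation J := (jordan0 R n.+1).
Local Notation e := (elast R n).

Lemma lbm_comp (g : 'cV[R]_n.+1 -> R) x : continuous g ->
  abs_continuous_half_line x -> locally_bounded_measurable (fun t => g (x t)).
Proof.
move=> cg acx; apply: lbm_continuous => T T0 t.
have cx := half_line_within (b := T) acx (lexx 0).
exact: (continuous_comp (cx t) (cg (x t))).
Qed.

Definition running_cost x := integral0 (fun t => F (x t)).

Lemma running_costP x : abs_continuous_half_line x ->
  primitive (running_cost x) (fun t => F (x t)).
Proof.
by move=> acx; apply: integral0P; apply: lbm_comp => //; exact: cost_continuous.
Qed.

Lemma cost_split x T : abs_continuous_half_line x -> 0 <= T ->
  cost F x = ((running_cost x T)%:E +
    \int[lebesgue_measure]_(t in `]T, +oo[) (F (x t))%:E)%E.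
Proof.
move=> acx T0; have [mF bF] := lbm_comp (cost_continuous F_C1) acx.
rewrite /cost (integral_primitive_split mF bF _ (running_costP acx) T0).
  by rewrite /running_cost integral00 subr0.
by move=> t _; exact: (cost_ge0 F_posdef).
Qed.

Lemma running_cost_le x T : abs_continuous_half_line x -> 0 <= T ->
  ((running_cost x T)%:E <= cost F x)%E.
Proof.
move=> acx T0; rewrite (cost_split acx T0) leeDl// integral_ge0// => t _.
by rewrite lee_fin (cost_ge0 F_posdef).
Qed.

Lemma cost_le_support x l M : abs_continuous_half_line x -> 0 <= l ->
  (forall t, 0 <= t <= l -> F (x t) <= M) -> (forall t, l <= t -> x t = 0) ->
  (cost F x <= (M * l)%:E)%E.
Proof.
move=> acx l0 FM x0; rewrite (cost_split acx l0) integral0_eq ?adde0.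
  rewrite lee_fin.
  have := primitive_slope (running_costP acx) (lexx 0) l0 (c := M).
  rewrite subr0 {2}/running_cost integral00 subr0; apply.
  by apply: aeW => t; exact: FM.
move=> t /=; rewrite in_itv/= andbT => lt.
by rewrite x0 ?(F_posdef.1)// ltW.
Qed.

(* The speed of x is at most |x| + 1. *)
Lemma stays_large (u : R -> R) x (r : R) :
  vprimitive x (fun t => J *m x t + u t *: e) ->
  {ae lebesgue_measure, forall t : R, 0 <= t -> -1 <= u t <= 1} ->
  0 <= r -> forall t, r <= t <= r + `|x r| / (4 * (`|x r| + 1)) ->
    `|x r| / 2 <= `|x t|.
Proof.
move=> px u1 r0 t.
set m := `|x r|; set s := m / (4 * (m + 1)) => trs.
have m0 : 0 <= m by exact: normr_ge0.
have m1 : 0 < 4 * (m + 1) by lra.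
have s0 : 0 <= s by rewrite divr_ge0//; lra.
have sE : s * (4 * (m + 1)) = m by rewrite /s divfK// gt_eqF.
have s4 : s <= 1 / 4 by rewrite /s ler_pdivrMr//; lra.
have rs : r <= r + s by lra.
have cx : {within `[r, r + s], continuous (fun t => `|x t|)}.
  have cx := half_line_within (b := r + s) px.1 r0.
  by move=> z; exact: (continuous_comp (cx z) (@norm_continuous _ _ (x z))).
(* At time [c] the norm is largest. Since [s <= 1 / 4], the speed bound there, this norm plus 1, is
   at most 4/3 of [m + 1], so the displacement over the window is at most a third of [m]. *)
have [c crs cmax] := EVT_max rs cx.
have mN : m <= `|x c| by apply: cmax; rewrite in_itv/= lexx.
have key z : r <= z <= r + s -> `|x z - x r| <= (`|x c| + 1) * s.
  move=> /andP[rz zs]; apply: cV_norm_le => [|i].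
    by rewrite mulr_ge0// addr_ge0.
  rewrite !mxE; have /vprimitiveP/(_ i) pxi := px.
  have := primitive_slope_norm pxi r0 rz (c := `|x c| + 1).
  have hae : {ae mu, forall t : R, r <= t <= z ->
      `|(J *m x t + u t *: e) i 0| <= `|x c| + 1}.
    apply: ae_imply u1 => w uw /andP[rw wz]; rewrite jordan0_coord.
    case: ifP => _.
      have /andP[h1 h2] := uw (le_trans r0 rw).
      by rewrite ler_norml; have := normr_ge0 (x c); lra.
    apply: (le_trans (cV_norm_coord _ _)).
    have := cmax w; rewrite in_itv/= rw (le_trans wz zs) => /(_ isT); lra.
  move=> /(_ hae) /le_trans; apply; rewrite ler_wpM2l ?addr_ge0//; lra.
have := key c; rewrite in_itv/= in crs => /(_ crs) k1.
have k2 := key t trs.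
have n1 := ler_normD (x c - x r) (x r); rewrite subrK -/m in n1.
have n2 := ler_normB (x t) (x t - x r); rewrite opprB addrC subrK -/m in n2.
have : `|x c| * s <= `|x c| * (1 / 4) by rewrite ler_wpM2l.
nra.
Qed.

(** By [stays_large], a state of norm at least [r] keeps half of its norm for a time between [s0]
    and 1, during which [F] is at least [m] times that half. The constant is uniform over
    trajectories. *)
Lemma cost_barrier (r : R) : 0 < r -> exists2 k, 0 < k &
  forall (u : R -> R) x t,
  vprimitive x (fun t => J *m x t + u t *: e) ->
  {ae lebesgue_measure, forall t : R, 0 <= t -> -1 <= u t <= 1} ->
  0 <= t -> r <= `|x t| ->
  k * `|x t| <= running_cost x (t + 1) - running_cost x t.
Proof.
move=> r0; have r20 : 0 < r / 2 by lra.
have [m m0 mP] := cost_growth F_C1 F_convex F_posdef r20.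
pose s0 := r / (4 * (r + 1)).
have s00 : 0 < s0 by rewrite divr_gt0//; lra.
exists (s0 * m / 2) => [|u x t px u1 t0 rx].
  by rewrite divr_gt0// mulr_gt0.
pose N := `|x t|; pose s := N / (4 * (N + 1)).
have N0 : 0 < N by exact: lt_le_trans rx.
have s0s : s0 <= s.
  have a1 : 0 < 4 * (r + 1) by lra.
  have a2 : 0 < 4 * (N + 1) by lra.
  rewrite /s0 /s ler_pdivrMr// mulrAC ler_pdivlMr//.
  by move: rx; rewrite -/N; lra.
have s1 : s <= 1 by rewrite /s ler_pdivrMr; lra.
have acx := px.1.
have large := stays_large px u1 t0.
have ts : t <= t + s by lra.
have pG := running_costP acx.
have := primitive_slope (primitiveN pG) t0 ts (c := - (m * (N / 2))).
have hae : {ae mu, forall z : R, t <= z <= t + s ->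
    - F (x z) <= - (m * (N / 2))}.
  apply: aeW => z tz; rewrite lerN2.
  have h := large z tz.
  apply: le_trans (mP _ _).
    by rewrite ler_wpM2l// ltW.
  by apply: le_trans h; rewrite ler_pM2r.
move=> /(_ hae) h.
have : running_cost x (t + s) <= running_cost x (t + 1).
  apply: (primitive_nondecreasing pG); [lra|lra|].
  by apply: aeW => z _; exact: (cost_ge0 F_posdef).
have : m * (N / 2) * s0 <= m * (N / 2) * s.
  by rewrite ler_wpM2l// mulr_ge0 ?ltW//; lra.
rewrite -/N; lra.
Qed.

End trajectory_cost.

(** * A priori bounds, convergence and uniqueness for optimal arcs *)

Section optimal_arcs.
Context {R : realType} {n : nat}.
Variable F : 'cV[R]_n.+1 -> R.
Hypotheses (F_C1 : continuously_differentiable F)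
  (F_convex : strictly_convex F) (F_posdef : positive_definite F).
Implicit Types (x p q : R -> 'cV[R]_n.+1) (u : R -> R) (a : 'cV[R]_n.+1).
Let mu := @lebesgue_measure R.
Local Notation J := (jordan0 R n.+1).
Local Notation e := (elast R n).

Lemma trajectoryP a u x : trajectory a u x <->
  x 0 = a /\ vprimitive x (fun t => J *m x t + u t *: e).
Proof. by split=> [[? ? ?]|[? [? ?]]]. Qed.

(** Comparison with the trajectory steered to 0, which stays in a known ball and rests at 0 after
    time [1 + K * r]. *)
Lemma optimal_cost_le : exists2 K : R, 0 < K & forall r M a u x, 0 <= r ->
  (forall z, `|z| <= (1 + K * r) ^+ n * (K * r) -> F z <= M) ->
  `|a| <= r -> optimal F a u x -> (cost F x <= (M * (1 + K * r))%:E)%E.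
Proof.
have [K K0 KP] := @steering R n; exists K => // r M a u x r0 FM xr [_ _ opt].
have [v [y [adv try yb y0]]] := KP a.
have Kx : 0 <= K * `|a| by rewrite mulr_ge0// ltW.
have Kr : K * `|a| <= K * r by rewrite ler_pM2l.
have yb' t : 0 <= t -> `|y t| <= (1 + K * r) ^+ n * (K * r).
  move=> t0; apply: (le_trans (yb t t0)); apply: ler_pM => //.
    by rewrite exprn_ge0// addr_ge0.
  by rewrite lerXn2r ?nnegrE ?addr_ge0// ?lerD2l// (le_trans Kx).
apply: (le_trans (opt v y adv try)).
have [_ [acy _]] := (trajectoryP _ _ _).1 try.
apply: (cost_le_support F_C1 F_posdef acy) => [|t /andP[t0 _]|t rt].
- by rewrite addr_ge0// (le_trans Kx).
- by apply: FM; exact: yb'.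
- by apply: y0; apply: le_trans rt; rewrite lerD2l.
Qed.

Lemma optimal_running_cost_bounded (r : R) : exists V : R,
  forall a u x T, `|a| <= r -> optimal F a u x -> 0 <= T ->
    running_cost F x T <= V.
Proof.
have [K K0 KP] := optimal_cost_le.
have [M M0 MP] := cost_gradient_bounded F_C1 F_posdef ((1 + K * r) ^+ n * (K * r)).
exists (M * (1 + K * r)) => a u x T xr op T0.
have [_ tx _] := op; have [_ [acx _]] := (trajectoryP _ _ _).1 tx.
rewrite -lee_fin; apply: le_trans (running_cost_le F_C1 F_posdef acx T0) _.
apply: (KP r M a u x (le_trans (normr_ge0 a) xr) _ xr op).
by move=> z /MP[].
Qed.

Lemma optimal_running_cost_small (c : R) : 0 < c -> exists2 d, 0 < d &
  forall a u x T, `|a| <= d -> optimal F a u x -> 0 <= T ->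
    running_cost F x T <= c.
Proof.
move=> c0; have [K K0 KP] := optimal_cost_le.
have c2 : 0 < c / 2 by rewrite divr_gt0.
have [d d0 dP] := cost_gradient_small F_C1 F_posdef c2.
have p2 : 0 < 2 ^+ n :> R by rewrite exprn_gt0.
(* This radius makes the steering last at most 2, hence the target [c / 2] for [F], and keeps the
   steered state within [d]. *)
pose r := Num.min 1 (d / 2 ^+ n) / K.
have r0 : 0 < r by rewrite divr_gt0// lt_min ltr01 divr_gt0.
have Kr : K * r = Num.min 1 (d / 2 ^+ n) by rewrite mulrC divfK// gt_eqF.
have Kr1 : K * r <= 1 by rewrite Kr ge_min lexx.
have Kr0 : 0 < K * r by rewrite mulr_gt0.
exists r => // a u x T xr op T0.
have [_ tx _] := op; have [_ [acx _]] := (trajectoryP _ _ _).1 tx.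
rewrite -lee_fin; apply: le_trans (running_cost_le F_C1 F_posdef acx T0) _.
have := KP r (c / 2) a u x (ltW r0) _ xr op.
have hyp z : `|z| <= (1 + K * r) ^+ n * (K * r) -> F z <= c / 2.
  move=> zr; have [] // := dP z; apply: (le_trans zr).
  apply: (@le_trans _ _ (2 ^+ n * (d / 2 ^+ n))).
    apply: ler_pM.
    - by rewrite exprn_ge0// addr_ge0// ltW.
    - exact: ltW.
    - by rewrite lerXn2r// ?nnegrE; lra.
    - by rewrite Kr ge_min lexx orbT.
  by rewrite mulrC divfK// gt_eqF.
move=> /(_ hyp) /le_trans; apply; rewrite lee_fin.
have : c / 2 * (1 + K * r) <= c / 2 * 2 by rewrite ler_pM2l//; lra.
by rewrite divfK.
Qed.

Lemma running_cost_nondecreasing x (s t : R) : abs_continuous_half_line x ->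
  0 <= s -> s <= t -> running_cost F x s <= running_cost F x t.
Proof.
move=> acx s0 st.
apply: (primitive_nondecreasing (running_costP F_C1 acx) s0 st).
by apply: aeW => z _; exact: (cost_ge0 F_posdef).
Qed.

Lemma optimal_admissible a u x : optimal F a u x ->
  {ae mu, forall t : R, 0 <= t -> -1 <= u t <= 1}.
Proof. by case=> -[]. Qed.

Lemma optimal_vprimitive a u x : optimal F a u x ->
  vprimitive x (fun t => J *m x t + u t *: e).
Proof. by case=> _ /trajectoryP[]. Qed.

Lemma optimal_state_le (r : R) : 0 < r -> exists2 k, 0 < k &
  forall a u x V, optimal F a u x ->
  (forall T, 0 <= T -> running_cost F x T <= V) ->
  forall t, 0 <= t -> r <= `|x t| -> k * `|x t| <= V.
Proof.
move=> r0; have [k k0 kP] := cost_barrier F_C1 F_convex F_posdef r0.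
exists k => // a u x V op GV t t0 rx.
have px := optimal_vprimitive op.
apply: (le_trans (kP u x t px (optimal_admissible op) t0 rx)).
have := GV (t + 1) ltac:(lra).
have := running_cost_nondecreasing px.1 (lexx 0) t0.
rewrite [running_cost F x 0]integral00; lra.
Qed.

Lemma optimal_state_bounded (r : R) : exists B : R,
  forall a u x t, `|a| <= r -> optimal F a u x -> 0 <= t -> `|x t| <= B.
Proof.
have [V VP] := optimal_running_cost_bounded r.
have [k k0 kP] := optimal_state_le ltr01.
exists (Num.max 1 (V / k)) => a u x t xr op t0; rewrite le_max.
have [//|x1] := leP `|x t| 1.
rewrite ler_pdivlMr// mulrC; apply: (kP a u x V op _ t t0 (ltW x1)).
by move=> T; exact: VP xr op.
Qed.

Lemma optimal_state_small (c : R) : 0 < c -> exists2 d, 0 < d &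
  forall a u x t, `|a| <= d -> optimal F a u x -> 0 <= t -> `|x t| <= c.
Proof.
move=> c0; have [k k0 kP] := optimal_state_le c0.
(* Half of the cost that reaching norm [c] would entail. *)
have [|d d0 dP] := @optimal_running_cost_small (k * c / 2).
  by rewrite divr_gt0// mulr_gt0.
exists d => // a u x t xd op t0; rewrite leNgt; apply/negP => cx.
have := kP a u x (k * c / 2) op _ t t0 (ltW cx).
move=> /(_ (fun T => dP a u x T xd op)).
have : k * c < k * `|x t| by rewrite ltr_pM2l.
have : 0 < k * c by rewrite mulr_gt0.
lra.
Qed.

(** The running cost is nondecreasing and bounded, so its increments over unit time eventually fall
    below [k * c], whereas the barrier makes them larger whenever the norm of the state exceeds
    [c]. *)
Lemma optimal_state_cvg0 a u x (c : R) : optimal F a u x -> 0 < c ->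
  exists2 T, 0 <= T & forall t, T <= t -> `|x t| <= c.
Proof.
move=> op c0; have px := optimal_vprimitive op.
have [k k0 kP] := cost_barrier F_C1 F_convex F_posdef c0.
have [V VP] := optimal_running_cost_bounded `|a|.
pose S := [set running_cost F x t | t in [set t | 0 <= t]].
have S0 : S (running_cost F x 0) by exists 0 => /=.
have supS : has_sup S.
  split; first by exists (running_cost F x 0).
  by exists V => _ [t t0 <-]; exact: (VP a u x t (lexx _) op).
have kc : 0 < k * c by rewrite mulr_gt0.
have [_ [T T0 <-] GT] := sup_adherent kc supS.
exists T => // t Tt; rewrite leNgt; apply/negP => cx.
have t0 : 0 <= t by exact: le_trans Tt.
have := kP u x t px (optimal_admissible op) t0 (ltW cx).
have : running_cost F x (t + 1) <= sup S.
  by apply: sup_upper_bound => //; exists (t + 1) => //=; lra.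
have := running_cost_nondecreasing px.1 T0 Tt.
have : k * c < k * `|x t| by rewrite ltr_pM2l.
lra.
Qed.

Lemma lift_vprimitive u x p : extremal_lift F u x p ->
  vprimitive p (fun t => - J^T *m p t + gradient F (x t)).
Proof. by move=> [[_ ? _ ?] _]. Qed.

(** The last coordinate of [p] is the switching function and vanishes in every window of length
    [2 * M + 1]; [window_bound] then carries the gradient bound over to all coordinates. Since the
    starting time [s] is arbitrary, tails are covered too. *)
Lemma lift_bound (M : R) : 0 <= M -> exists2 K : R, 0 < K &
  forall u x p (s d : R), 0 <= s -> 0 < d ->
  vprimitive x (fun t => J *m x t + u t *: e) -> extremal_lift F u x p ->
  (forall t, s <= t -> `|x t| <= M) ->
  (forall t, s <= t -> `|gradient F (x t)| <= d) ->
  forall t, s <= t -> `|p t| <= K * d.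
Proof.
move=> M0; have [|K K0 KP] := @window_bound R n (2 * M + 1); first lra.
exists K => // u x p s d s0 d0 px lift xM gd t st.
have [_ hu] := lift; have pp := lift_vprimitive lift.
have [/chain_coordP[_ pxn] /adjoint_coordP[p00 pS]] := (px, pp).
apply: cV_norm_le => [|i]; first by rewrite mulr_ge0 ?ltW.
have E0 : inord 0 = 0 :> 'I_n.+1 by apply/val_inj; rewrite /= inordK.
have En : inord n = ord_max :> 'I_n.+1 by apply/val_inj; rewrite /= inordK.
have := KP (fun k t => p t (inord k) 0) (fun k t => gradient F (x t) (inord k) 0)
  s d s0 d0 _ pS _ _ i t.
rewrite inord_val E0 En => h; apply: h => //.
- move=> k z kn sz; apply: le_trans (cV_norm_coord _ _) _; exact: gd.
- move=> z sz; apply: (zero_in_window s0 pxn _ hu _ sz).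
    by have /vprimitiveP/(_ ord_max)[] := pp.
  by move=> w sw; apply: le_trans (cV_norm_coord _ _) _; exact: xM.
- by rewrite -ltnS.
Qed.

Lemma optimal_lift_bounded (r : R) : exists B : R,
  forall a u x p t, `|a| <= r -> optimal F a u x -> extremal_lift F u x p ->
    0 <= t -> `|x t| + `|p t| <= B.
Proof.
have [B BP] := optimal_state_bounded r.
have [N N0 NP] := cost_gradient_bounded F_C1 F_posdef `|B|.
have [K K0 KP] := lift_bound (normr_ge0 B).
exists (`|B| + K * N) => a u x p t xr op lift t0; apply: lerD.
  exact: le_trans (BP a u x t xr op t0) (ler_norm _).
have xB s : 0 <= s -> `|x s| <= `|B|.
  by move=> s0; exact: le_trans (BP a u x s xr op s0) (ler_norm _).
apply: (KP u x p 0 N (lexx 0) N0 (optimal_vprimitive op) lift) => // s s0.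
by case: (NP (x s) (xB s s0)).
Qed.

Lemma lift_small (c : R) : 0 < c -> exists2 d, 0 < d &
  forall u x p (s : R), 0 <= s ->
  vprimitive x (fun t => J *m x t + u t *: e) -> extremal_lift F u x p ->
  (forall t, s <= t -> `|x t| <= d) ->
  forall t, s <= t -> `|x t| + `|p t| <= c.
Proof.
move=> c0; have [K K0 KP] := lift_bound ler01.
have cK : 0 < c / 2 / K by rewrite !divr_gt0.
have [d d0 dP] := cost_gradient_small F_C1 F_posdef cK.
(* The entry 1 is the state bound for which [K] was obtained; [d] and [c / 2] control the gradient
   and the state. *)
exists (Num.min (c / 2) (Num.min d 1)) => [|u x p s s0 px lift xd t st].
  by rewrite !lt_min d0 ltr01 divr_gt0.
have {}xd z : s <= z -> [/\ `|x z| <= c / 2, `|x z| <= d & `|x z| <= 1].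
  by move=> /xd; rewrite !le_min => /and3P[].
rewrite [leRHS]splitr; apply: lerD; first by case: (xd t st).
have -> : c / 2 = K * (c / 2 / K) by rewrite [RHS]mulrC divfK// gt_eqF.
apply: (KP u x p s _ s0 cK px lift) => // z sz; have [_ h1 h2] := xd z sz => //.
by case: (dP (x z) h1).
Qed.

Lemma optimal_lift_small (c : R) : 0 < c -> exists2 d, 0 < d &
  forall a u x p t, `|a| <= d -> optimal F a u x -> extremal_lift F u x p ->
    0 <= t -> `|x t| + `|p t| <= c.
Proof.
move=> c0; have [d1 d10 d1P] := lift_small c0.
have [d d0 dP] := optimal_state_small d10.
exists d => // a u x p t xd op lift t0.
apply: (d1P u x p 0 (lexx 0) (optimal_vprimitive op) lift) => // s.
exact: dP xd op.
Qed.

Lemma optimal_lift_cvg0 a u x p (c : R) : optimal F a u x ->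
  extremal_lift F u x p -> 0 < c ->
  exists2 T, 0 <= T & forall t, T <= t -> `|x t| + `|p t| <= c.
Proof.
move=> op lift c0; have [d d0 dP] := lift_small c0.
have [T T0 TP] := optimal_state_cvg0 op d0; exists T => //.
exact: (dP u x p T T0 (optimal_vprimitive op) lift TP).
Qed.

Lemma primitive0_cvg0 (f : R -> R) :
  (forall c, 0 < c -> exists2 T, 0 <= T & forall t, T <= t -> `|f t| <= c) ->
  forall phi, primitive f phi -> (forall t, 0 <= t -> phi t = 0) ->
  forall t, 0 <= t -> f t = 0.
Proof.
move=> f0 phi pf phi0 t t0; apply/eqP; rewrite -normr_le0; apply/ler_addgt0Pl.
move=> c c0; rewrite addr0; have [T T0 TP] := f0 c c0.
have := primitive_unique pf (primitive_cst (f 0)) (ae_ge0_forall phi0) erefl.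
move=> h; rewrite h// -(h (Num.max t T)); last by rewrite le_max t0.
by apply: TP; rewrite le_max lexx orbT.
Qed.

(** The difference solves the homogeneous adjoint equation and tends to 0. Its first coordinate is
    constant, hence 0; then the second is constant, and so on. *)
Lemma lift_unique a u x p q : optimal F a u x ->
  extremal_lift F u x p -> extremal_lift F u x q ->
  forall t, 0 <= t -> q t = p t.
Proof.
move=> op lp lq.
have pr : vprimitive (fun t => q t + -1 *: p t)
    (fun t => - J^T *m (q t + -1 *: p t) + 0).
  apply: (eq_vprimitive (vprimitive_lin (-1) (lift_vprimitive lq)
    (lift_vprimitive lp))) => //.
  apply: ae_ge0_forall => t _; rewrite addr0 mulmxDr -scalemxAr !scaleN1r opprD.
  by rewrite addrACA subrr addr0.
set r := fun t => q t + -1 *: p t in pr.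
have r0 c : 0 < c -> exists2 T, 0 <= T & forall t, T <= t -> `|r t| <= c.
  move=> c0; have c2 : 0 < c / 2 by rewrite divr_gt0.
  have [T1 T10 T1P] := optimal_lift_cvg0 op lp c2.
  have [T2 T20 T2P] := optimal_lift_cvg0 op lq c2.
  exists (Num.max T1 T2) => [|t]; first by rewrite le_max T10.
  rewrite ge_max => /andP[t1 t2]; rewrite /r (le_trans (ler_normD _ _))//.
  rewrite scaleN1r normrN; have := T1P t t1; have := T2P t t2.
  have := normr_ge0 (x t); lra.
have ri0 i c : 0 < c -> exists2 T, 0 <= T & forall t, T <= t -> `|r t i 0| <= c.
  move=> /r0[T T0 TP]; exists T => // t /TP.
  exact: le_trans (cV_norm_coord _ _).
have /adjoint_coordP[p00 pS] := pr.
have zero k : (k <= n)%N -> forall t, 0 <= t -> r t (inord k) 0 = 0.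
  elim: k => [_|k ih kn].
    have -> : inord 0 = 0 :> 'I_n.+1 by apply/val_inj; rewrite /= inordK.
    by apply: (primitive0_cvg0 (ri0 0) p00) => t _; rewrite mxE.
  apply: (primitive0_cvg0 (ri0 _) (pS k kn)) => t t0.
  by rewrite (ih (ltnW kn) t t0) mxE oppr0 addr0.
move=> t t0; apply/eqP; rewrite -subr_eq0 -scaleN1r; apply/eqP/matrixP => i j.
have := zero i (ltn_ord i) t t0; rewrite inord_val (ord1 j) => ->.
by rewrite mxE.
Qed.

End optimal_arcs.

(** * Pairing functions with variations of the control *)

Section pairing.
Context {R : realType}.
Let mu := @lebesgue_measure R.
Implicit Types (phi psi w u : R -> R) (P : {poly R}).

Definition vanishes_after (T : R) w : Prop := forall t : R, T <= t -> w t = 0.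

(* 0 when w does not vanish eventually. *)
Definition support_end w : R :=
  xget 0 [set T | 0 <= T /\ vanishes_after T w].

(** Integral of [phi * w] over the half-line for eventually vanishing [w], made a total function of
    [w] so that it can serve as a functional in the multiplier rule. *)
Definition pairing phi w : R :=
  integral0 (fun t => phi t * w t) (support_end w).

Lemma support_endP w T : 0 <= T -> vanishes_after T w ->
  0 <= support_end w /\ vanishes_after (support_end w) w.
Proof.
by move=> T0 wT; apply: (@xgetPex _ 0 [set T | 0 <= T /\ vanishes_after T w]); exists T.
Qed.

Lemma primitive_constant_after (f phi : R -> R) (S T : R) : primitive f phi ->
  0 <= S -> S <= T -> vanishes_after S phi -> f T = f S.
Proof.
move=> pf S0 ST phi0; apply/eqP; rewrite -subr_eq0 -normr_le0.
rewrite -[leRHS](mul0r (T - S)); apply: (primitive_slope_norm pf S0 ST).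
by apply: aeW => t /andP[St _]; rewrite phi0// normr0.
Qed.

(** Primitives are constant after the end of the support, so any of them, read at any later time,
    computes the pairing. *)
Lemma pairingE (f phi w : R -> R) (T : R) : 0 <= T -> vanishes_after T w ->
  primitive f (fun t => phi t * w t) -> locally_bounded_measurable phi ->
  locally_bounded_measurable w -> pairing phi w = f T - f 0.
Proof.
move=> T0 wT pf bphi bw; have [S0 wS] := support_endP T0 wT.
set S := support_end w in S0 wS.
have phiw0 U : vanishes_after U w -> vanishes_after U (fun t => phi t * w t).
  by move=> wU t Ut; rewrite wU ?mulr0.
have pI := integral0P (lbmM bphi bw).
have := primitive_unique pI (primitiveB pf (primitive_cst (f 0))) _ _ S0.
rewrite integral00 subrr => h.
rewrite /pairing -/S h//; last by apply: ae_ge0_forall => t _; rewrite subr0.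
congr (_ - _); have [ST|TS] := leP S T.
  by rewrite (primitive_constant_after pf S0 ST (phiw0 _ wS)).
by rewrite (primitive_constant_after pf T0 (ltW TS) (phiw0 _ wT)).
Qed.

Lemma pairing_linl phi psi (c : R) w (T : R) : 0 <= T -> vanishes_after T w ->
  locally_bounded_measurable phi -> locally_bounded_measurable psi ->
  locally_bounded_measurable w ->
  pairing (fun t => phi t + c * psi t) w = pairing phi w + c * pairing psi w.
Proof.
move=> T0 wT bphi bpsi bw.
have p1 := integral0P (lbmM bphi bw); have p2 := integral0P (lbmM bpsi bw).
rewrite (pairingE T0 wT p1)// (pairingE T0 wT p2)// !integral00 !subr0.
rewrite (@pairingE (fun t => integral0 (fun t => phi t * w t) t
  + c * integral0 (fun t => psi t * w t) t) _ _ T)//.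
- by rewrite !integral00; ring.
- apply: (eq_primitive (primitiveD p1 (primitiveZ c p2))) => //.
  by apply: ae_ge0_forall => t _; ring.
- apply: lbmD => //; apply: lbmM => //; exact: lbm_cst.
Qed.

Lemma pairing_linr phi w1 w2 (a b T : R) : 0 <= T ->
  vanishes_after T w1 -> vanishes_after T w2 ->
  locally_bounded_measurable phi ->
  locally_bounded_measurable w1 -> locally_bounded_measurable w2 ->
  pairing phi (fun t => a * w1 t + b * w2 t) =
    a * pairing phi w1 + b * pairing phi w2.
Proof.
move=> T0 w1T w2T bphi b1 b2.
have p1 := integral0P (lbmM bphi b1); have p2 := integral0P (lbmM bphi b2).
rewrite (pairingE T0 w1T p1)// (pairingE T0 w2T p2)// !integral00 !subr0.
rewrite (@pairingE (fun t => a * integral0 (fun t => phi t * w1 t) t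
  + b * integral0 (fun t => phi t * w2 t) t) _ _ T)//.
- by rewrite !integral00; ring.
- by move=> t Tt; rewrite w1T// w2T//; ring.
- apply: (eq_primitive (primitiveD (primitiveZ a p1) (primitiveZ b p2))) => //.
  by apply: ae_ge0_forall => t _; ring.
- by apply: lbmD; apply: lbmM => //; exact: lbm_cst.
Qed.

Lemma lbm_horner P : locally_bounded_measurable (horner P).
Proof. exact: lbm_primitive (primitive_horner P). Qed.

Lemma pairing_poly phi (c : nat -> R) (m : nat) w (T : R) : 0 <= T ->
  vanishes_after T w -> locally_bounded_measurable phi ->
  locally_bounded_measurable w ->
  pairing (fun t => phi t + (\sum_(j < m) c j *: 'X^j).[t]) w =
    pairing phi w + \sum_(j < m) c j * pairing (horner 'X^j) w.
Proof.
move=> T0 wT bphi bw; elim: m => [|m ih].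
  rewrite !big_ord0 addr0; congr pairing; apply/funext => t.
  by rewrite horner0 addr0.
rewrite !big_ord_recr/= addrA -ih -(pairing_linl _ T0 wT)//.
- congr pairing; apply/funext => t.
  by rewrite hornerD hornerZ addrA.
- by apply: lbmD => //; exact: lbm_horner.
- exact: lbm_horner.
Qed.

(** The constraint is imposed at every time rather than almost everywhere; this suits a control
    clipped everywhere to [-1, 1] and makes [w] bounded. *)
Definition variations u : set (R -> R) := [set w |
  [/\ measurable_fun (`[0, +oo[ : set R) w,
      (forall t, -1 <= u t + w t <= 1) &
      exists2 T, 0 <= T & vanishes_after T w]].

Lemma variations_lbm u w : (forall t, -1 <= u t <= 1) -> variations u w ->
  locally_bounded_measurable w.
Proof.
move=> u1 [mw uw _]; split => // T _; exists 2 => t _.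
by have := u1 t; have := uw t; rewrite ler_norml; lra.
Qed.

Lemma variations_convex u : convex_on (variations u).
Proof.
move=> a b h [ma ua [S S0 aS]] [mb ub [T T0 bT]] /andP[h0 h1]; split.
- apply: measurable_funD; apply: measurable_funM => //.
- move=> t; rewrite !fctE /GRing.scale/=.
  have /andP[a1 a2] := ua t; have /andP[b1 b2] := ub t.
  have h1' : 0 <= 1 - h by lra.
  have := ler_wpM2l h0 a1; have := ler_wpM2l h0 a2.
  have := ler_wpM2l h1' b1; have := ler_wpM2l h1' b2.
  lra.
- exists (Num.max S T) => [|t]; first by rewrite le_max S0.
  rewrite ge_max => /andP[h2 h3]; rewrite !fctE /GRing.scale/= aS// bT//; ring.
Qed.

Lemma pairing_affine u phi : (forall t, -1 <= u t <= 1) ->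
  locally_bounded_measurable phi -> affine_on (variations u) (pairing phi).
Proof.
move=> u1 bphi a b h va vb h01.
have [_ _ [S S0 aS]] := va; have [_ _ [T T0 bT]] := vb.
rewrite -(@pairing_linr phi a b h (1 - h) (Num.max S T))//.
- by rewrite le_max S0.
- by move=> t; rewrite ge_max => /andP[h1 _]; exact: aS.
- by move=> t; rewrite ge_max => /andP[_ h1]; exact: bT.
- exact: variations_lbm va.
- exact: variations_lbm vb.
Qed.

Lemma primitive_flat (f phi : R -> R) (T : R) : primitive f phi ->
  (forall t, 0 <= t < T -> f t = 0) ->
  {ae mu, forall t, 0 < t -> t < T -> phi t = 0}.
Proof.
move=> [_ df] f0; apply: ae_imply df => t dft t0 tT.
have [_ <-] := dft (ltW t0).
have [_] : is_derive t 1 f 0.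
  apply: near_eq_is_derive (is_derive_cst 0 t 1); near=> z.
  rewrite f0//; apply/andP; split; last by near: z; exact: lt_nbhsl.
  by apply: ltW; near: z; exact: lt_nbhsr.
by [].
Unshelve. all: by end_near. Qed.

Lemma sgr_measurable : measurable_fun setT (Num.sg : R -> R).
Proof.
apply: nondecreasing_measurable => // x y xy.
by case: (sgrP x) => hx; case: (sgrP y) => hy; lra.
Qed.

(* Tested on w = sgn psi - u, truncated at time N. *)
Lemma sgn_of_variations u psi :
  measurable_fun (`[0, +oo[ : set R) u -> (forall t, -1 <= u t <= 1) ->
  locally_bounded_measurable psi ->
  (forall w, variations u w -> pairing psi w <= 0) ->
  {ae mu, forall t, 0 <= t -> set_sgn (psi t) (u t)}.
Proof.
move=> mu_ u1 bpsi neg.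
have sgE y v : `|v| <= 1 -> (y != 0 -> y * (Num.sg y - v) = 0) -> set_sgn y v.
  rewrite ler_norml => v1 yv; rewrite /set_sgn; have [y0|y0] := eqVneq y 0.
    by rewrite /= in_itv.
  move: (yv y0) => /eqP; rewrite mulf_eq0 (negbTE y0)/= subr_eq0 => /eqP <- /=.
  by rewrite [X in X / _]numEsg mulfK// normr_eq0.
(* Bounded intervals suffice, as a countable union of null sets is null. *)
suff h (N : nat) : {ae mu, forall t, 0 < t -> t < N%:R ->
    psi t * (Num.sg (psi t) - u t) = 0}.
  have := ae_foralln h.
  move/(ae_imply2 (Q := fun t => 0 <= t -> set_sgn (psi t) (u t))).
  move=> /(_ _ _ (ae_gt0 (P := fun t => 0 < t) (fun t h => h))); apply.
  move=> t ht t0' t0; apply: sgE => [|_]; first by rewrite ler_norml.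
  apply: (ht (Num.Def.archi_bound t)); first exact: t0'.
  exact: archi_boundP.
pose w t := if t < N%:R then Num.sg (psi t) - u t else 0.
have vw : variations u w.
  split.
  - apply: measurable_fun_if => //; first exact: measurable_fun_ltr.
    apply: (measurable_funS _ (@subIsetl _ _ _)) => //.
    apply: measurable_funB => //; apply: (measurableT_comp sgr_measurable).
    exact: bpsi.1.
  - move=> t; rewrite /w; case: ltP => _; last by rewrite addr0.
    by rewrite addrC subrK /Num.sg; case: ifP => _; [|case: ifP => _]; lra.
  - by exists N%:R => // t; rewrite /w ltNge => ->.
have bw := variations_lbm u1 vw.
have pG := integral0P (lbmM bpsi bw).
have wN : vanishes_after N%:R w by move=> t; rewrite /w ltNge => ->.
have := neg w vw; rewrite (pairingE _ wN pG)// integral00 subr0 => GN.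
have pos t : 0 <= psi t * w t.
  rewrite /w; case: ltP => _; last by rewrite mulr0.
  have := u1 t; rewrite /Num.sg; case: eqVneq => [->|_]; first by rewrite mul0r.
  by case: ltP => h1 /andP[h2 h3]; nra.
(* A nonnegative integrand with nonpositive total integral: its primitive is identically 0 up to
   [N], and so is its rate almost everywhere. *)
have G0 t : 0 <= t < N%:R -> integral0 (fun t => psi t * w t) t = 0.
  move=> /andP[t0 tN]; apply/eqP; rewrite eq_le; apply/andP; split.
    apply: (le_trans _ GN); apply: (primitive_nondecreasing pG t0 (ltW tN)).
    exact: aeW.
  rewrite -[leLHS](integral00 (fun t => psi t * w t)).
  by apply: (primitive_nondecreasing pG _ t0) => //; exact: aeW.
apply: ae_imply (primitive_flat pG G0) => t h t0 tN.
by have := h t0 tN; rewrite /w tN.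
Qed.

End pairing.

(** * Existence of an extremal lift *)

Section lift_existence.
Context {R : realType} {n : nat}.
Let mu := @lebesgue_measure R.
Local Notation J := (jordan0 R n.+1).
Local Notation e := (elast R n).

(** [variations] works with bounds at all times, which a control has only almost everywhere; on the
    half-line, clipping alters it on a null set. *)
Lemma clip_control (u : R -> R) : admissible_control u -> exists v : R -> R,
  [/\ measurable_fun (`[0, +oo[ : set R) v, forall t, -1 <= v t <= 1 &
      {ae mu, forall t, 0 <= t -> u t = v t}].
Proof.
move=> [mu_ u1]; exists (fun t => Num.max (-1) (Num.min 1 (u t))); split.
- by apply: measurable_maxr => //; apply: measurable_minr.
- move=> t; rewrite le_max lexx/= ge_max ge_min lexx/= andbT; lra.
- apply: ae_imply u1 => t /[apply] /andP[h1 h2].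
  by rewrite (min_idPr h2) (max_idPr h1).
Qed.

Lemma derivn_XsubC_exp (c : R) j :
  (('X - c%:P) ^+ j)^`(j) = (j`!)%:R :> {poly R}.
Proof.
elim: j => [|j ih]; first by rewrite derivn0 expr0 fact0.
rewrite derivSn deriv_exp/= derivXsubC mul1r derivnMn ih factS natrM.
by rewrite mulr_natl.
Qed.

(** The arc of ['X - T] to the power [n - i] is, at time [T], a nonzero multiple of the [i]-th basis
    vector. *)
Lemma poly_arc_separates (h : 'cV[R]_n.+1) (T : R) :
  (forall P : {poly R}, (size P <= n.+1)%N -> dotp (poly_arc P T) h = 0) -> h = 0.
Proof.
move=> hP; apply/matrixP => i j; rewrite (ord1 j) mxE {j}.
have := hP (('X - T%:P) ^+ (n - i)); rewrite size_exp_XsubC ltnS leq_subr.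
move=> /(_ isT); rewrite /dotp (bigD1 i)//= big1 => [|k ki].
  rewrite addr0 mxE derivn_XsubC_exp => /eqP.
  rewrite -polyC_natr hornerC mulf_eq0 mulf_eq0 expf_eq0 oppr_eq0 oner_eq0 andbF/=.
  by rewrite pnatr_eq0 -leqn0 leqNgt fact_gt0/= => /eqP.
rewrite mxE; have [lt|gt|eq] := ltngtP (n - k) (n - i).
- suff /rootP -> : root (('X - T%:P) ^+ (n - i))^`(n - k) T.
    by rewrite mulr0 mul0r.
  rewrite root_factor_theorem -[X in X %| _]expr1.
  by apply: dvdp_exp_derivn; apply: dvdp_exp2l; rewrite add1n.
- by rewrite derivn_poly0 ?size_exp_XsubC// horner0 mulr0 mul0r.
- case/eqP: ki; apply/val_inj => /=.
  by rewrite -(subKn (ltn_ord k : k <= n)%N) eq subKn// -ltnS.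
Qed.

Variable F : 'cV[R]_n.+1 -> R.
Hypotheses (F_C1 : continuously_differentiable F)
  (F_convex : strictly_convex F) (F_posdef : positive_definite F).
Implicit Types (x p h : R -> 'cV[R]_n.+1) (u v w : R -> R) (a : 'cV[R]_n.+1).

Lemma lbm_gradient x i : abs_continuous_half_line x ->
  locally_bounded_measurable (fun t => gradient F (x t) i 0).
Proof.
move=> acx; apply: (lbm_comp (g := fun z => gradient F z i 0)) => // z.
exact: (continuous_comp (F_C1.2 z) (@coord_continuous _ _ _ i 0 _)).
Qed.

Lemma lbm_dotp x h : (forall i, locally_bounded_measurable (fun t => x t i 0)) ->
  abs_continuous_half_line h -> locally_bounded_measurable (fun t => dotp (x t) (h t)).
Proof.
move=> bx ach; rewrite /dotp; elim: (index_enum _) => [|i s ih].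
  by under eq_fun do rewrite big_nil; exact: lbm_cst.
under eq_fun do rewrite big_cons.
apply: lbmD => //; apply: lbmM => //; apply: (lbm_comp (g := fun z => z i 0) _ ach).
exact: coord_continuous.
Qed.

Lemma vbounded x T : abs_continuous_half_line x -> 0 <= T ->
  exists2 N, 0 < N & forall t, 0 <= t <= T -> `|x t| <= N.
Proof.
move=> acx T0.
have [_ /(_ T T0)[N NP]] := lbm_comp (@norm_continuous _ _) acx.
exists (`|N| + 1) => [|t /NP]; first by rewrite ltr_wpDl.
by rewrite normr_id => /le_trans; apply; rewrite (le_trans (ler_norm _))// lerDl.
Qed.

(** The scalar product of a polynomial arc with [h] has rate [P * w], so its value at [T] is a
    combination of moments of [w], that is 0; polynomial arcs at [T] separate vectors. *)
Lemma moments_zero (h : R -> 'cV[R]_n.+1) w (T : R) :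
  locally_bounded_measurable w -> h 0 = 0 ->
  vprimitive h (fun t => J *m h t + w t *: e) ->
  0 <= T -> vanishes_after T w ->
  (forall j, (j < n.+1)%N -> pairing (horner 'X^j) w = 0) -> h T = 0.
Proof.
move=> bw h0 ph T0 wT mom; apply: (@poly_arc_separates _ T) => P sP.
have pd := adjoint_product (poly_arcP sP) ph.
have pd' : primitive (fun t => dotp (poly_arc P t) (h t))
    (fun t => (\sum_(j < n.+1) P`_j *: 'X^j).[t] * w t).
  apply: (eq_primitive pd) => //; apply: ae_ge0_forall => t _.
  rewrite poly_arc_last /dotp big1 ?add0r => [|i _]; last by rewrite mxE mul0r.
  rewrite -poly_def; congr (_.[t] * _); apply/polyP => k.
  rewrite coef_poly; case: ltnP => // nk.
  by rewrite nth_default// (leq_trans sP).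
have := pairing_poly (phi := fun=> 0) (fun j => P`_j) n.+1 T0 wT (lbm_cst 0) bw.
have -> : (fun t => 0 + (\sum_(j < n.+1) P`_j *: 'X^j).[t]) =
    horner (\sum_(j < n.+1) P`_j *: 'X^j).
  by apply/funext => t; rewrite add0r.
rewrite (pairingE T0 wT pd' (lbm_horner _) bw) h0.
rewrite (pairingE (f := fun=> 0) T0 wT _ (lbm_cst 0) bw); last first.
  apply: (eq_primitive (primitive_cst 0)) => //.
  by apply: ae_ge0_forall => t _; rewrite mul0r.
rewrite subrr add0r big1 => [|j _]; last by rewrite mom ?mulr0.
by rewrite /dotp [X in _ - X]big1 ?subr0// => i _; rewrite [X in _ * X]mxE mulr0.
Qed.

(** Both costs have the same tail, which can be cancelled because it is finite: steering makes the
    optimal cost finite. *)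
Lemma compare_running_cost a u v x h (T : R) : optimal F a u x ->
  admissible_control v -> trajectory a v h -> 0 <= T ->
  (forall t, T <= t -> h t = x t) -> running_cost F x T <= running_cost F h T.
Proof.
move=> op av tv T0 xh; have [_ _ opt] := op.
have acx := (optimal_vprimitive op).1.
have ach : abs_continuous_half_line h by case: tv.
have := opt v h av tv.
rewrite (cost_split F_C1 F_posdef acx T0) (cost_split F_C1 F_posdef ach T0).
have -> : (\int[lebesgue_measure]_(t in `]T, +oo[) (F (h t))%:E =
    \int[lebesgue_measure]_(t in `]T, +oo[) (F (x t))%:E)%E.
  apply: eq_integral => t; rewrite inE/= in_itv/= andbT => Tt.
  by rewrite xh// ltW.
have [K K0 KP] := @optimal_cost_le R n F F_C1 F_posdef.
have [M M0 MP] := cost_gradient_bounded F_C1 F_posdef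
  ((1 + K * `|a|) ^+ n * (K * `|a|)).
have fin := KP `|a| M a u x (normr_ge0 a) (fun z hz => (MP z hz).1) (lexx _) op.
rewrite (cost_split F_C1 F_posdef acx T0) in fin.
set I := (\int[_]_(t in _) _)%E in fin *.
have I0 : (0 <= I)%E.
  by apply: integral_ge0 => t _; rewrite lee_fin (cost_ge0 F_posdef).
by move: fin I0; case: I => [r| |]//= _ _; rewrite lee_fin lerD2r.
Qed.

(** For small [c > 0] the arc [x + c h] competes with [x]. The gradient inequality at the perturbed
    point bounds the increase of [F] by [c] times the product of the gradient there with [h];
    uniform continuity moves this gradient back to [x] at the price of an arbitrary [eta]. *)
Lemma first_variation a u v x w h (T : R) : optimal F a u x ->
  measurable_fun (`[0, +oo[ : set R) v -> (forall t, -1 <= v t <= 1) ->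
  {ae mu, forall t, 0 <= t -> u t = v t} ->
  variations v w -> h 0 = 0 -> vprimitive h (fun t => J *m h t + w t *: e) ->
  0 <= T -> (forall t, T <= t -> h t = 0) ->
  0 <= integral0 (fun t => dotp (gradient F (x t)) (h t)) T.
Proof.
move=> op mv v1 uv vw h0 ph T0 hT.
have px := optimal_vprimitive op.
have acx := px.1; have ach := ph.1.
have [N N0 NP] := vbounded ach T0.
have [X X0 XP] := vbounded acx T0.
have bg := lbm_dotp (fun i => lbm_gradient i acx) ach.
set G := integral0 _.
have pG : primitive G (fun t => dotp (gradient F (x t)) (h t)) := integral0P bg.
have key eta : 0 < eta -> 0 <= G T + n.+1%:R * (eta * N) * T.
  move=> eta0.
  have [d d0 dP] := gradient_unif_continuous F_C1 X eta0.
  (* [c <= 1] keeps the perturbed control admissible by convexity, and the other entry keeps the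
     perturbation below the modulus [d]. *)
  pose c := Num.min 1 (d / (2 * N)).
  have c0 : 0 < c by rewrite lt_min ltr01 divr_gt0// mulr_gt0.
  have c1 : c <= 1 by rewrite ge_min lexx.
  have cN : c * N < d.
    have : c <= d / (2 * N) by rewrite ge_min lexx orbT.
    rewrite ler_pdivlMr ?mulr_gt0//; lra.
  pose y t := x t + c *: h t.
  have py : vprimitive y (fun t => J *m y t + (v t + c * w t) *: e).
    apply: (eq_vprimitive (vprimitive_lin c px ph)) => //.
    apply: ae_imply uv => t /[apply] ->.
    rewrite /y mulmxDr -scalemxAr scalerDr scalerA scalerDl.
    by rewrite addrACA.
  have ady : admissible_control (fun t => v t + c * w t).
    have [mw vw1 _] := vw; split.
      by apply: measurable_funD => //; apply: measurable_funM.
    apply: ae_ge0_forall => t _.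
    have /andP[w1 w2] := vw1 t; have /andP[v1' v2] := v1 t.
    have := ler_wpM2l (ltW c0) w1; have := ler_wpM2l (ltW c0) w2.
    have c1' : 0 <= 1 - c by lra.
    have := ler_wpM2l c1' v1'; have := ler_wpM2l c1' v2.
    lra.
  have ty : trajectory a (fun t => v t + c * w t) y.
    apply/trajectoryP; split => //; rewrite /y h0 scaler0 addr0.
    by case: op => _ /trajectoryP[].
  have yT t : T <= t -> y t = x t.
    by move=> Tt; rewrite /y hT// scaler0 addr0.
  have cmp := compare_running_cost op ady ty T0 yT.
  have acy := py.1.
  have pFx := running_costP F_C1 acx; have pFy := running_costP F_C1 acy.
  pose D := n.+1%:R * (eta * N).
  have := primitive_slope (primitiveB (primitiveB pFy pFx) (primitiveZ c pG))
    (lexx 0) T0 (c := c * D).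
  have hae : {ae mu, forall t : R, 0 <= t <= T ->
      F (y t) - F (x t) - c * dotp (gradient F (x t)) (h t) <= c * D}.
    apply: aeW => t tT.
    have := gradient_ineq F_C1 F_convex (y t) (x t).
    have -> : x t - y t = (- c) *: h t by rewrite /y opprD addrA subrr add0r scaleNr.
    rewrite dotpZr => g1.
    have xy : `|x t - y t| < d.
      rewrite /y opprD addrA subrr add0r normrN normrZ gtr0_norm//.
      by apply: le_lt_trans cN; rewrite ler_pM2l// NP.
    have g2 := dP (x t) (y t) (XP t tT) xy.
    have g3 : dotp (gradient F (y t)) (h t) - dotp (gradient F (x t)) (h t) <= D.
      rewrite -dotpBl; apply: (le_trans (ler_norm _)).
      apply: (le_trans (dotp_norm _ _)); rewrite ler_wpM2l//.
      by apply: ler_pM => //; [rewrite distrC ltW | exact: NP].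
    have : c * (dotp (gradient F (y t)) (h t) - dotp (gradient F (x t)) (h t))
        <= c * D by rewrite ler_wpM2l// ltW.
    lra.
  move=> /(_ hae); rewrite /running_cost /G !integral00 -/(running_cost F x)
    -/(running_cost F y) -/G => h1.
  have : 0 <= c * (G T + D * T) by lra.
  by rewrite pmulr_rge0.
rewrite leNgt; apply/negP => GT.
pose q := n.+1%:R * N * T.
have q0 : 0 <= q by rewrite !mulr_ge0// ltW.
(* For this [eta] the error is at most half of [- G T], which contradicts [G T < 0]. *)
have := key (- G T / (2 * (q + 1))).
rewrite divr_gt0; [|lra|lra] => /(_ isT).
have -> : n.+1%:R * (- G T / (2 * (q + 1)) * N) * T =
    - G T / (2 * (q + 1)) * q by rewrite /q; ring.
have : - G T / (2 * (q + 1)) * q <= - G T / 2.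
  rewrite -mulrA ler_wpM2l; [by []|lra|].
  rewrite mulrC ler_pdivrMr; lra.
lra.
Qed.

(** Otherwise [sgn_of_variations] puts [u] in the sign of [P]. The last coordinate of an optimal [x]
    being bounded, [P] would vanish in every window of a fixed length and have infinitely many
    zeros. *)
Lemma nonzero_poly_variation a u v x (P : {poly R}) : optimal F a u x ->
  measurable_fun (`[0, +oo[ : set R) v -> (forall t, -1 <= v t <= 1) ->
  {ae mu, forall t, 0 <= t -> u t = v t} ->
  P != 0 -> exists2 w, variations v w & 0 < pairing (horner P) w.
Proof.
move=> op mv v1 uv P0; apply: contrapT => /forall2NP no.
have hv : {ae mu, forall t, 0 <= t -> set_sgn P.[t] (v t)}.
  apply: sgn_of_variations => //; first exact: lbm_horner.
  move=> w vw; rewrite leNgt; apply/negP => h.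
  by case: (no w).
have hu : {ae mu, forall t, 0 <= t -> set_sgn P.[t] (u t)}.
  by apply: ae_imply2 hv uv => t h1 h2 t0; rewrite h2//; exact: h1.
have [B BP] := optimal_state_bounded F_C1 F_convex F_posdef `|a|.
have /chain_coordP[_ pxn] := optimal_vprimitive op.
have xB t : 0 <= t -> `|x t ord_max 0| <= B.
  by move=> t0; apply: le_trans (cV_norm_coord _ _) _; exact: BP (lexx _) op t0.
have B0 : 0 <= B := le_trans (normr_ge0 _) (xB 0 (lexx 0)).
have zeros := zero_in_window (lexx 0) pxn (primitive_horner P).1 hu xB.
(* One more than the window length, so that the windows starting at multiples of [L] are disjoint
   and give distinct zeros. *)
pose L := 2 * B + 2.
have L0 : 0 < L by rewrite /L; lra.
have zj (j : nat) : exists z, j%:R * L <= z < j.+1%:R * L /\ P.[z] = 0.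
  have [|z /andP[z1 z2] Pz] := zeros (j%:R * L); first by rewrite mulr_ge0// ltW.
  exists z; split => //; rewrite z1/=; apply: (le_lt_trans z2).
  have -> : j.+1%:R * L = j%:R * L + L by rewrite -natr1 mulrDl mul1r.
  by rewrite /L; lra.
have /choice[z zP] := zj.
have zmono (i j : nat) : (i < j)%N -> z i < z j.
  move=> ij; have [/andP[_ h1] _] := zP i; have [/andP[h2 _] _] := zP j.
  apply: (lt_le_trans h1); apply: le_trans h2.
  by rewrite ler_pM2r// ler_nat.
have zinj : injective z.
  move=> i j zij; apply/eqP; rewrite eqn_leq; apply/andP; split;
    by rewrite leqNgt; apply/negP => /zmono; rewrite zij ltxx.
have := max_poly_roots P0 (rs := map z (iota 0 (size P))).
rewrite map_inj_uniq// iota_uniq size_map size_iota ltnn => h.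
suff : false by [].
apply: h => //; apply/allP => _ /mapP[i _ ->]; apply/rootP.
by case: (zP i).
Qed.

Lemma lift_exists a u x : optimal F a u x -> exists p, extremal_lift F u x p.
Proof.
move=> op; have [adu tx _] := op.
have [v [mv v1 uv]] := clip_control adu.
have px := optimal_vprimitive op.
have [p0 pp0] := @adjoint_exists R n (fun t => gradient F (x t))
  (fun i => lbm_gradient i px.1).
have /vprimitiveP/(_ ord_max) p0n := pp0.
have bp0 : locally_bounded_measurable (fun t => p0 t ord_max 0).
  exact: lbm_primitive p0n.
have [c cP] : exists c : nat -> R, forall w, variations v w ->
    pairing (fun t => p0 t ord_max 0) w +
    \sum_(j < n.+1) c j * pairing (horner 'X^j) w <= 0.
  (* The objective is the pairing with the last coordinate of [p0]; the constraints are the moments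
     of order 0 to [n]. *)
  apply: (@lagrange_multipliers R (R -> R : lmodType R) (variations v)
    (fun j => pairing (horner 'X^j)) n.+1).
  - exact: variations_convex.
  - by move=> k _; apply: pairing_affine => //; exact: lbm_horner.
  - move=> k s c kn s0.
    (* Its coefficient of degree [k] is [s], so qualification reduces to the case of a nonzero
       polynomial. *)
    pose P := s *: 'X^k + \sum_(j < k) c j *: 'X^j.
    have P0 : P != 0.
      apply/eqP => /(congr1 (fun p : {poly R} => p`_k)); rewrite coef0 /P coefD.
      rewrite coefZ coefXn eqxx mulr1 coef_sum big1 ?addr0 => [/eqP|j _].
        by rewrite (negbTE s0).
      by rewrite coefZ coefXn gtn_eqF ?mulr0.
    have [w vw Pw] := nonzero_poly_variation op mv v1 uv P0; exists w => //.
    have [_ _ [T T0 wT]] := vw; have bw := variations_lbm v1 vw.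
    have := pairing_poly (phi := horner (s *: 'X^k)) c k T0 wT (lbm_horner _) bw.
    have -> : (fun t => (s *: 'X^k).[t] + (\sum_(j < k) c j *: 'X^j).[t]) = horner P.
      by apply/funext => t; rewrite hornerD.
    move=> E; move: Pw; rewrite E; congr (0 < _ + _).
    have := pairing_linl (phi := fun=> 0) (psi := horner 'X^k) s T0 wT (lbm_cst 0)
      (lbm_horner _) bw.
    have -> : (fun t => 0 + s * ('X^k).[t]) = horner (s *: 'X^k).
      by apply/funext => t; rewrite add0r hornerZ.
    move=> ->; rewrite (pairingE (f := fun=> 0) T0 wT _ (lbm_cst 0) bw) ?subrr ?add0r//.
    apply: (eq_primitive (primitive_cst 0)) => //.
    by apply: ae_ge0_forall => t _; rewrite mul0r.
  - exact: pairing_affine.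
  - move=> w vw mom.
    have [_ _ [T T0 wT]] := vw; have bw := variations_lbm v1 vw.
    have [h [h0 ph]] := @chain_exists R n w bw.
    have hT t : T <= t -> h t = 0.
      move=> Tt; apply: (moments_zero bw h0 ph _ _ mom); first exact: le_trans Tt.
      by move=> s ts; apply: wT; exact: le_trans ts.
    have G0 := first_variation op mv v1 uv vw h0 ph T0 hT.
    (* As [h] vanishes at 0 and at [T], duality makes the pairing with [p0] equal to minus the
       integral of the gradient against [h]. *)
    have pd := adjoint_product pp0 ph.
    have pG := integral0P (lbm_dotp (fun i => lbm_gradient i px.1) ph.1).
    have pd' : primitive (fun t => dotp (p0 t) (h t) -
        integral0 (fun t => dotp (gradient F (x t)) (h t)) t)
        (fun t => p0 t ord_max 0 * w t).
      apply: (eq_primitive (primitiveB pd pG)) => //.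
      by apply: ae_ge0_forall => t _; rewrite addrC addKr.
    rewrite (pairingE T0 wT pd' bp0 bw) integral00 h0 hT//.
    rewrite /dotp !big1 => [|i _|i _]; rewrite ?mxE ?mulr0//; lra.
pose P := \sum_(j < n.+1) c j *: 'X^j.
have sP : (size P <= n.+1)%N.
  apply: (leq_trans (size_sum _ _ _)); apply/bigmax_leqP => j _.
  by rewrite (leq_trans (size_scale_leq _ _))// size_polyXn.
have sgv : {ae mu, forall t, 0 <= t -> set_sgn (p0 t ord_max 0 + P.[t]) (v t)}.
  apply: sgn_of_variations => //; first by apply: lbmD => //; exact: lbm_horner.
  move=> w vw; have [_ _ [T T0 wT]] := vw; have bw := variations_lbm v1 vw.
  by rewrite (pairing_poly c n.+1 T0 wT bp0 bw); exact: cP.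
(* Correction of [p0] by the homogeneous arc with last coordinate [P], in the form that
   [vprimitive_lin] expects. *)
pose p t := p0 t + 1 *: poly_arc P t.
have pn t : p t ord_max 0 = p0 t ord_max 0 + P.[t].
  by rewrite /p scale1r mxE poly_arc_last.
have pp : vprimitive p (fun t => - J^T *m p t + gradient F (x t)).
  apply: (eq_vprimitive (vprimitive_lin 1 pp0 (poly_arcP sP))) => //.
  apply: ae_ge0_forall => t _; rewrite /p !scale1r addr0 mulmxDr.
  by rewrite addrAC.
have sgu : {ae mu, forall t, 0 <= t -> set_sgn (p t ord_max 0) (u t)}.
  by apply: ae_imply2 sgv uv => t h1 h2 t0; rewrite h2// pn; exact: h1.
exists p; split => //; split; [exact: px.1|exact: pp.1| |exact: pp.2].
by apply: ae_imply2 sgu px.2 => t h1 h2 t0; exists (u t); [exact: h1|exact: h2].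
Qed.

End lift_existence.

(** * Comparison functions of class K-infinity and norm equivalences *)

Section comparison_functions.
Context {R : realType}.
Let mu := @lebesgue_measure R.

(* C r = r + the mean of B over [r, 2 r]. *)
Lemma Kinfty_majorant (B : R -> R) :
  (forall r, 0 <= r -> 0 <= B r) ->
  (forall r s, 0 <= r -> r <= s -> B r <= B s) ->
  (forall c, 0 < c -> exists2 d, 0 < d & B d <= c) ->
  exists C : R -> R, class_Kinfty C /\ forall r, 0 <= r -> B r <= C r.
Proof.
move=> B0 Bmono Bsmall.
have bB : locally_bounded_measurable B.
  split.
    (* Freezing [B] at negative arguments makes it monotone on the whole line, hence measurable. *)
    have : measurable_fun (`[0, +oo[ : set R) (fun r => B (Num.max 0 r)).
      apply: nondecreasing_measurable => // r s rs; apply: Bmono.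
        by rewrite le_max lexx.
      by rewrite ge_max !le_max lexx/= rs orbT.
    apply: eq_measurable_fun => r; rewrite inE/= in_itv/= andbT => r0.
    by congr B; exact/max_idPr.
  move=> T T0; exists (B T) => t /andP[t0 tT].
  by rewrite ger0_norm; [exact: Bmono | exact: B0].
pose G := integral0 B.
have pG : primitive G B := integral0P bB.
have Gle a b : 0 <= a -> a <= b -> G b - G a <= B b * (b - a).
  move=> a0 ab; apply: (primitive_slope pG a0 ab).
  by apply: aeW => t /andP[at_ tb]; apply: Bmono => //; exact: le_trans at_.
have Gge a b : 0 <= a -> a <= b -> B a * (b - a) <= G b - G a.
  move=> a0 ab; have := primitive_slope (primitiveN pG) a0 ab (c := - B a).
  have h : {ae mu, forall t : R, a <= t <= b -> - B t <= - B a}.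
    by apply: aeW => t /andP[at_ tb]; rewrite lerN2; exact: Bmono.
  by move=> /(_ h); lra.
(* Cross-multiplied: the mean of a nondecreasing function does not decrease when the right end of
   the interval moves right, and likewise below for the left end. *)
have mean_r a b b' : 0 <= a -> a <= b -> b <= b' ->
    (G b - G a) * (b' - a) <= (G b' - G a) * (b - a).
  move=> a0 ab bb'.
  have p0 : 0 <= b - a by lra.
  have q0 : 0 <= b' - b by lra.
  have := ler_wpM2r q0 (Gle a b a0 ab).
  have := ler_wpM2r p0 (Gge b b' (le_trans a0 ab) bb').
  lra.
have mean_l a a' b : 0 <= a -> a <= a' -> a' <= b ->
    (G b - G a) * (b - a') <= (G b - G a') * (b - a).
  move=> a0 aa' a'b.
  have p0 : 0 <= a' - a by lra.
  have q0 : 0 <= b - a' by lra.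
  have := ler_wpM2r q0 (Gle a a' a0 aa').
  have := ler_wpM2r p0 (Gge a' b (le_trans a0 aa') a'b).
  lra.
pose m r := (G (2 * r) - G r) / r.
(* The mean dominates [B r], and its bound by [B (2 * r)] will give continuity of the majorant at
   0. *)
have mge r : 0 < r -> B r <= m r.
  move=> r0; rewrite ler_pdivlMr//.
  have := Gge r (2 * r) (ltW r0); rewrite (_ : 2 * r - r = r); last by ring.
  by apply; lra.
have mle r : 0 < r -> m r <= B (2 * r).
  move=> r0; rewrite ler_pdivrMr//.
  have := Gle r (2 * r) (ltW r0); rewrite (_ : 2 * r - r = r); last by ring.
  by apply; lra.
have mmono r s : 0 < r -> r <= s -> m r <= m s.
  move=> r0 rs; have s0 : 0 < s by exact: lt_le_trans rs.
  rewrite /m ler_pdivrMr// mulrAC ler_pdivlMr//.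
  (* From [[r, 2 r]] to [[s, 2 s]] by way of [[r, 2 s]]. *)
  have h1 := mean_r r (2 * r) (2 * s) (ltW r0) ltac:(lra) ltac:(lra).
  have h2 := mean_l r s (2 * s) (ltW r0) rs ltac:(lra).
  have d0 : 0 < 2 * s - r by lra.
  rewrite -(ler_pM2r d0).
  have := ler_wpM2r (ltW s0) h1; have := ler_wpM2r (ltW r0) h2.
  rewrite (_ : 2 * r - r = r) 1?(_ : 2 * s - s = s); [lra|ring|ring].
exists (fun r => if r == 0 then 0 else r + m r); split; last first.
  move=> r; rewrite le_eqVlt => /predU1P[<-|r0]; last first.
    by rewrite gt_eqF//; have := mge r r0; lra.
  (* At 0 the majorant is 0, and so [B] must be at most 0 there: it is nondecreasing and takes
     arbitrarily small values at positive arguments. *)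
  rewrite eqxx; apply/ler_addgt0Pl => c c0; rewrite addr0.
  by have [d d0 dc] := Bsmall c c0; apply: le_trans dc; apply: Bmono => //; exact: ltW.
split.
- apply/subspace_continuousP => r /=; rewrite in_itv/= andbT le_eqVlt.
  move=> /predU1P[<-|r0].
    apply/cvgrPdist_lt => c c0; rewrite /from_subspace eqxx.
    have c2 : 0 < c / 2 by rewrite divr_gt0.
    have [d d0 dc] := Bsmall _ c2.
    rewrite near_withinE; exists (Num.min (d / 2) (c / 2)) => /=.
      by rewrite lt_min c2 divr_gt0.
    move=> s; rewrite /= sub0r normrN lt_min => /andP[s1 s2]; rewrite in_itv/= andbT.
    rewrite sub0r normrN le_eqVlt => /predU1P[<-|s0].
      by rewrite eqxx normr0.
    rewrite gt_eqF// ger0_norm; last first.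
      by rewrite addr_ge0 ?(ltW s0)// (le_trans _ (mge s s0))// B0// ltW.
    rewrite gtr0_norm// in s1 s2.
    have : B (2 * s) <= B d by apply: Bmono; lra.
    by have := mle s s0; lra.
  rewrite /from_subspace; apply: cvg_within_filter.
  have cG (t : R) : 0 < t -> G z @[z --> t] --> G t.
    move=> t0; apply/cvgrPdist_lt => c c0.
    have t1 : 0 <= t + 1 by lra.
    have [d d0 dP] := abs_continuous_modulus (pG.1 (t + 1) t1) c0.
    apply/nbhs_ballP; exists (Num.min d (Num.min t 1)) => /=.
      by rewrite !lt_min d0 t0 ltr01.
    move=> z; rewrite /ball/= !lt_min => /and3P[z1 z2 z3]; apply: dP => //.
      by apply/andP; split; lra.
    by move: z2 z3; rewrite !ltr_norml => /andP[? ?] /andP[? ?]; apply/andP; split; lra.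
  have c2 : G (2 * z) @[z --> r] --> G (2 * r).
    apply: (@cvg_comp _ _ _ (fun z => 2 * z) G _ (nbhs (2 * r))).
      by apply: cvgM; [exact: cvg_cst | exact: cvg_id].
    by apply: cG; rewrite mulr_gt0.
  rewrite gt_eqF//.
  have cm : z + m z @[z --> r] --> r + m r.
    apply: cvgD; first exact: cvg_id.
    apply: cvgM; first exact: (cvgB c2 (cG r r0)).
    by apply: cvgV; [rewrite gt_eqF | exact: cvg_id].
  apply: cvg_trans cm; apply: near_eq_cvg; near=> z.
  rewrite gt_eqF//; near: z; exact: lt_nbhsr.
- move=> r s; rewrite !in_itv/= !andbT !le_eqVlt => /predU1P[<-|r0] _ rs.
    rewrite eqxx gt_eqF//.
    by have := mge s rs; have := B0 s (ltW rs); lra.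
  have s0 : 0 < s by exact: lt_trans rs.
  by rewrite !gt_eqF//; have := mmono r s r0 (ltW rs); lra.
- move=> M; pose r := `|M| + 1.
  have r0 : 0 < r by rewrite ltr_wpDl.
  exists r; first exact: ltW.
  rewrite gt_eqF//; have := mge r r0; have := B0 r (ltW r0).
  by have := ler_norm M; rewrite /r; lra.
- by rewrite eqxx.
Unshelve. all: by end_near. Qed.

Lemma enorm_le (m : nat) (v : 'cV[R]_m) : enorm v <= m%:R * `|v|.
Proof.
rewrite -[leRHS]ger0_norm ?mulr_ge0// -sqrtr_sqr ler_wsqrtr//.
apply: (@le_trans _ _ (\sum_(i < m) `|v| ^+ 2)).
  apply: ler_sum => i _; rewrite -[X in X <= _]real_normK ?num_real//.
  by rewrite lerXn2r ?nnegrE// cV_norm_coord.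
rewrite sumr_const card_ord -[leLHS]mulr_natl exprMn ler_wpM2r ?exprn_ge0//.
by rewrite -natrX ler_nat; case: (m) => // k; rewrite expnS expn1 leq_pmulr.
Qed.

Lemma norm_le_enorm (m : nat) (v : 'cV[R]_m) : `|v| <= enorm v.
Proof.
apply: cV_norm_le => [|i]; first exact: sqrtr_ge0.
rewrite -sqrtr_sqr ler_wsqrtr// (bigD1 i)//= lerDl sumr_ge0// => j _.
exact: sqr_ge0.
Qed.

Lemma norm_col_mx_le (m k : nat) (v : 'cV[R]_m) (w : 'cV[R]_k) :
  `|col_mx v w| <= `|v| + `|w|.
Proof.
apply: cV_norm_le => [|i]; first by rewrite addr_ge0.
rewrite mxE; case: splitP => j _; apply: (le_trans (cV_norm_coord _ j)).
  by rewrite lerDl.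
by rewrite lerDr.
Qed.

End comparison_functions.

(** * Uniform bound of optimal extremals by the initial state *)

Section lift_majorant.
Context {R : realType} {n : nat}.
Variable F : 'cV[R]_n.+1 -> R.
Hypotheses (F_C1 : continuously_differentiable F)
  (F_convex : strictly_convex F) (F_posdef : positive_definite F).

(** The supremum over all optimal extremals starting in a ball is finite, nondecreasing in the
    radius and small near 0, so [Kinfty_majorant] applies to it. *)
Lemma optimal_lift_Kinfty : exists C : R -> R, class_Kinfty C /\
  forall a u (x p : R -> 'cV[R]_n.+1) t,
    optimal F a u x -> extremal_lift F u x p -> 0 <= t ->
    enorm (col_mx (x t) (p t)) <= C (enorm a).
Proof.
pose N : R := (n.+1 + n.+1)%:R.
have N0 : 0 < N by rewrite ltr0n.
(* The factor [N] converts max norms to the Euclidean norm of the stacked vector; the point 0 makes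
   the set nonempty and its supremum nonnegative. *)
pose S r := [set s : R | s = 0 \/ exists a u (x p : R -> 'cV[R]_n.+1) t,
  [/\ `|a| <= r, optimal F a u x, extremal_lift F u x p, 0 <= t &
      s = N * (`|x t| + `|p t|)]].
have Sub r : has_sup (S r).
  split; first by exists 0; left.
  have [B BP] := optimal_lift_bounded F_C1 F_convex F_posdef r.
  exists (Num.max 0 (N * B)) => _ [->|[a [u [x [p [t [ar op lp t0 ->]]]]]]].
    by rewrite le_max lexx.
  by rewrite le_max ler_pM2l// (BP a u x p t ar op lp t0) orbT.
have [||c c0|C [KC BC]] := @Kinfty_majorant R (fun r => sup (S r)).
- by move=> r _; apply: sup_upper_bound => //; left.
- move=> r s _ rs; apply: sup_le_ub; first by case: (Sub r).
  move=> y Sy; apply: sup_upper_bound => //; case: Sy; first by left.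
  move=> [a [u [x [p [t [ar op lp t0 yE]]]]]]; right; exists a, u, x, p, t.
  by split => //; exact: le_trans rs.
- have cN : 0 < c / N by rewrite divr_gt0.
  have [d d0 dP] := optimal_lift_small F_C1 F_convex F_posdef cN.
  exists d => //; apply: sup_le_ub; first by case: (Sub d).
  move=> _ [->|[a [u [x [p [t [ad op lp t0 ->]]]]]]]; first exact: ltW.
  by rewrite mulrC -ler_pdivlMr// (dP a u x p t ad op lp t0).
exists C; split => // a u x p t op lp t0.
apply: (le_trans (enorm_le _)).
apply: (@le_trans _ _ (N * (`|x t| + `|p t|))).
  by rewrite ler_pM2l// norm_col_mx_le.
apply: le_trans (BC _ (sqrtr_ge0 _)); apply: sup_upper_bound => //; right.
by exists a, u, x, p, t; split => //; exact: norm_le_enorm.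
Qed.

End lift_majorant.

Theorem theorem7p3 (R : realType) (n : nat) (F : 'cV[R]_n.+1 -> R)
    (F_C1 : continuously_differentiable F)
    (F_convex : strictly_convex F)
    (F_posdef : positive_definite F) :
  (forall (x0 : 'cV[R]_n.+1) (u : R -> R) (x : R -> 'cV[R]_n.+1),
     optimal F x0 u x ->
     exists p : R -> 'cV[R]_n.+1, extremal_lift F u x p /\
       forall q : R -> 'cV[R]_n.+1, extremal_lift F u x q ->
         forall t : R, 0 <= t -> q t = p t) /\
  (exists C : R -> R, class_Kinfty C /\
     forall (x0 : 'cV[R]_n.+1) (u : R -> R) (x p : R -> 'cV[R]_n.+1),
       optimal F x0 u x -> extremal_lift F u x p ->
       (ereal_sup [set (enorm (col_mx (x t) (p t)))%:E | t in `[0%R, +oo[]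
          <= (C (enorm x0))%:E)%E /\
       (x t, p t) @[t --> +oo] --> (0 : 'cV[R]_n.+1, 0 : 'cV[R]_n.+1)).
Proof.
split=> [a u x op|].
  have [p lp] := lift_exists F_C1 F_convex F_posdef op.
  exists p; split => // q lq t t0.
  exact: (lift_unique F_C1 F_convex F_posdef op lp lq t0).
have [C [KC CP]] := optimal_lift_Kinfty F_C1 F_convex F_posdef.
exists C; split => // a u x p op lp; split.
  apply: ge_ereal_sup => _ [t /= t0 <-]; rewrite lee_fin.
  by apply: (CP a u x p t op lp); move: t0; rewrite in_itv/= andbT.
(* One tail estimate, on the sum of the two norms, serves both components. *)
have cvg0 (y : R -> 'cV[R]_n.+1) :
    (forall t, `|y t| <= `|x t| + `|p t|) -> y t @[t --> +oo] --> (0 : 'cV[R]_n.+1).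
  move=> yxp; apply/cvgrPdist_le => c c0.
  have [T T0 TP] := optimal_lift_cvg0 F_C1 F_convex F_posdef op lp c0.
  near=> t; rewrite sub0r normrN; apply: (le_trans (yxp t)); apply: TP.
  by near: t; apply: nbhs_pinfty_ge; exact: num_real.
have xp t : `|x t| <= `|x t| + `|p t| by rewrite lerDl.
have px t : `|p t| <= `|x t| + `|p t| by rewrite lerDr.
exact: (cvg_pair (cvg0 x xp) (cvg0 p px)).
Unshelve. all: by end_near. Qed.
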